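(* For every countable model $(M,\mathcal{X})\models\mathrm{B}\Sigma^0_2+\mathrm{WKL}_0$ there is a second-order structure $(K,\mathcal{X})$ which is a proper end extension of $(M,\mathcal{X})$, is $\Sigma^0_2$-elementary over $(M,\mathcal{X})$, and satisfies $\mathrm{B}\Sigma^0_1$.
   Context: $\mathrm{WKL}_0$ is $\mathrm{RCA}_0$ (Robinson arithmetic, $\Sigma^0_1$-induction, $\Delta^0_1$-comprehension) plus: every infinite binary tree has an infinite path. $\mathrm{B}\Sigma^0_k$ is the collection scheme for $\Sigma^0_k$ formulas (with first- and second-order parameters). In $(K,\mathcal{X})$ the second-order universe is indexed by the same collection $\mathcal{X}$: each $A\in\mathcal{X}$ is interpreted as a subset of $K$ whose intersection with $M$ is $A$. Second-order structures are viewed as two-sorted first-order structures; $(M,\mathcal{X})\preccurlyeq_{\Sigma^0_2}(K,\mathcal{X})$ means every $\Sigma^0_2$ formula with parameters from $(M,\mathcal{X})$ has the same truth value in both; an end extension means every element of $K\setminus M$ is above every element of $M$; proper means $K\neq M$. *)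

(* Defs.v *)
From Stdlib Require Import Arith.

Record arith := {
  car  : Type;
  zero : car;
  one  : car;
  add  : car -> car -> car;
  mul  : car -> car -> car;
  lt   : car -> car -> Prop }.

(* A second-order (two-sorted) structure is an [arith] [A] together with a
   type [S] of (indices of) sets and a membership relation [mem : car A -> S -> Prop]. *)

(* ---------- syntax (de Bruijn indices for both sorts) ---------- *)
Inductive term : Type :=
| tvar  : nat -> term
| tzero : term
| tone  : term
| tadd  : term -> term -> term
| tmul  : term -> term -> term.

Inductive form : Type :=
| feq   : term -> term -> form
| flt   : term -> term -> form
| fmem  : term -> nat -> form
| fneg  : form -> form
| fand  : form -> form -> form
| for_  : form -> form -> form
| fimp  : form -> form -> form
| fball : term -> form -> form         (* ∀ x < t. φ  (t does not see x) *)
| fbex  : term -> form -> form         (* ∃ x < t. φ  (t does not see x) *)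
| fall  : form -> form
| fex   : form -> form
| fallS : form -> form
| fexS  : form -> form.

Definition scons {T : Type} (a : T) (e : nat -> T) : nat -> T :=
  fun n => match n with 0 => a | S k => e k end.

Fixpoint teval (A : arith) (e : nat -> car A) (t : term) : car A :=
  match t with
  | tvar i => e i
  | tzero => zero A
  | tone => one A
  | tadd t1 t2 => add A (teval A e t1) (teval A e t2)
  | tmul t1 t2 => mul A (teval A e t1) (teval A e t2)
  end.

Fixpoint sat (A : arith) (S : Type) (mem : car A -> S -> Prop)
    (phi : form) (e : nat -> car A) (se : nat -> S) : Prop :=
  match phi with
  | feq t1 t2 => teval A e t1 = teval A e t2
  | flt t1 t2 => lt A (teval A e t1) (teval A e t2)
  | fmem t i => mem (teval A e t) (se i)
  | fneg p => ~ sat A S mem p e se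
  | fand p q => sat A S mem p e se /\ sat A S mem q e se
  | for_ p q => sat A S mem p e se \/ sat A S mem q e se
  | fimp p q => sat A S mem p e se -> sat A S mem q e se
  | fball t p => forall a, lt A a (teval A e t) -> sat A S mem p (scons a e) se
  | fbex t p => exists a, lt A a (teval A e t) /\ sat A S mem p (scons a e) se
  | fall p => forall a, sat A S mem p (scons a e) se
  | fex p => exists a, sat A S mem p (scons a e) se
  | fallS p => forall s, sat A S mem p e (scons s se)
  | fexS p => exists s, sat A S mem p e (scons s se)
  end.

Inductive isD0 : form -> Prop :=
| D0eq t1 t2 : isD0 (feq t1 t2)
| D0lt t1 t2 : isD0 (flt t1 t2)
| D0mem t i : isD0 (fmem t i)
| D0neg p : isD0 p -> isD0 (fneg p)
| D0and p q : isD0 p -> isD0 q -> isD0 (fand p q)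
| D0or p q : isD0 p -> isD0 q -> isD0 (for_ p q)
| D0imp p q : isD0 p -> isD0 q -> isD0 (fimp p q)
| D0ball t p : isD0 p -> isD0 (fball t p)
| D0bex t p : isD0 p -> isD0 (fbex t p).

Inductive isSigma : nat -> form -> Prop :=
| Sig0 p : isD0 p -> isSigma 0 p
| SigPi k p : isPi k p -> isSigma (S k) p
| SigEx k p : isSigma (S k) p -> isSigma (S k) (fex p)
with isPi : nat -> form -> Prop :=
| Pi0 p : isD0 p -> isPi 0 p
| PiSig k p : isSigma k p -> isPi (S k) p
| PiAll k p : isPi (S k) p -> isPi (S k) (fall p).

Section Theories.
Context (A : arith) (S : Type) (mem : car A -> S -> Prop).
Local Notation "x + y" := (add A x y).
Local Notation "x * y" := (mul A x y).
Local Notation "x < y" := (lt A x y).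
Local Notation "0" := (zero A).
Local Notation "1" := (one A).

(* basic axioms of Robinson arithmetic with < (Simpson, SOSOA I.2.4(i)),
   plus Robinson's predecessor axiom *)
Definition basic_axioms : Prop :=
  (forall n, n + 1 <> 0) /\
  (forall m n, m + 1 = n + 1 -> m = n) /\
  (forall m, m + 0 = m) /\
  (forall m n, m + (n + 1) = (m + n) + 1) /\
  (forall m, m * 0 = 0) /\
  (forall m n, m * (n + 1) = m * n + m) /\
  (forall m, ~ m < 0) /\
  (forall m n, m < n + 1 <-> (m < n \/ m = n)) /\
  (forall n, n = 0 \/ exists m, n = m + 1).

Definition Sigma1_induction : Prop :=
  forall phi, isSigma 1 phi -> forall e se,
    sat A S mem phi (scons 0 e) se ->
    (forall n, sat A S mem phi (scons n e) se -> sat A S mem phi (scons (n + 1) e) se) ->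
    forall n, sat A S mem phi (scons n e) se.

Definition Delta1_comprehension : Prop :=
  forall phi psi, isSigma 1 phi -> isPi 1 psi -> forall e se,
    (forall n, sat A S mem phi (scons n e) se <-> sat A S mem psi (scons n e) se) ->
    exists X : S, forall n, mem n X <-> sat A S mem phi (scons n e) se.

Definition RCA0 : Prop :=
  basic_axioms /\ Sigma1_induction /\ Delta1_comprehension.

(* Collection scheme B Sigma^0_k: in [phi], variable 0 is y, variable 1 is x,
   the remaining number variables and all set variables are parameters. *)
Definition BSigma (k : nat) : Prop :=
  forall phi, isSigma k phi -> forall e se (a : car A),
    (forall x, x < a -> exists y, sat A S mem phi (scons y (scons x e)) se) ->
    exists b, forall x, x < a -> exists y, y < b /\ sat A S mem phi (scons y (scons x e)) se.

(* Binary strings are coded by the standard "heap" numbering: the empty string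
   is 1, and the children of (the string coded by) c are 2c (append 0) and
   2c+1 (append 1); 0 codes nothing. *)
Definition child (c d : car A) : Prop := d = c + c \/ d = (c + c) + 1.

Definition is_tree (T : S) : Prop :=
  (forall c, mem c T -> 0 < c) /\
  (forall p c, mem c T -> 0 < p -> child p c -> mem p T).

Definition infinite_set (X : S) : Prop := forall m, exists c, m < c /\ mem c X.

Definition is_path (T P : S) : Prop :=
  (forall c, mem c P -> mem c T) /\
  is_tree P /\
  mem 1 P /\
  (forall c, mem c P -> exists d, child c d /\ mem d P /\
       forall d', child c d' -> mem d' P -> d' = d).

Definition WKL : Prop :=
  forall T : S, is_tree T -> infinite_set T -> exists P : S, is_path T P.

Definition WKL0 : Prop := RCA0 /\ WKL.
End Theories.

Definition countable (T : Type) : Prop := exists f : T -> nat, forall x y, f x = f y -> x = y.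

Definition setsOf (M : arith) (X : (car M -> Prop) -> Prop) : Type := {Y : car M -> Prop | X Y}.
Definition memOf (M : arith) (X : (car M -> Prop) -> Prop) (a : car M) (Y : setsOf M X) : Prop :=
  proj1_sig Y a.

(* (K, X) extends (M, X) via f : M -> K, where each Y in X is interpreted in K
   by memK (_ , Y), a subset of K whose intersection with M is Y. *)
Definition is_extension (M K : arith) (X : (car M -> Prop) -> Prop)
    (memK : car K -> setsOf M X -> Prop) (f : car M -> car K) : Prop :=
  (forall a b, f a = f b -> a = b) /\
  f (zero M) = zero K /\ f (one M) = one K /\
  (forall a b, f (add M a b) = add K (f a) (f b)) /\
  (forall a b, f (mul M a b) = mul K (f a) (f b)) /\
  (forall a b, lt M a b <-> lt K (f a) (f b)) /\
  (forall a Y, memK (f a) Y <-> memOf M X a Y).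

Definition end_extension (M K : arith) (f : car M -> car K) : Prop :=
  forall k, (forall a, k <> f a) -> forall a, lt K (f a) k.

Definition proper_extension (M K : arith) (f : car M -> car K) : Prop :=
  exists k, forall a, k <> f a.

Definition Sigma_elementary (n : nat) (M K : arith) (S : Type)
    (memM : car M -> S -> Prop) (memK : car K -> S -> Prop) (f : car M -> car K) : Prop :=
  forall phi, isSigma n phi -> forall (e : nat -> car M) (se : nat -> S),
    sat M S memM phi e se <-> sat K S memK phi (fun i => f (e i)) se.

(* Main.v *)
(** The model [K] is an ultrapower of [M] whose elements are the functions of
    [X], restricted to a generic decreasing sequence [U] of unbounded sets of
    [X].  Such a power satisfies Los' theorem for Sigma^0_1 formulas, and
    Sigma^0_2-elementarity follows because a true Pi^0_2 sentence has Skolem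
    functions in [X].

    BSigma^0_2 gives the infinite pigeonhole principle for bounded functions of
    [X]; hence the sequence can be chosen so that every bounded function is
    eventually constant, which makes [K] an end extension.

    For BSigma^0_1 in [K], consider a bound [h] and a Sigma^0_1 relation
    [R(i, x)].  If unboundedly many [i] satisfy [R(i, x)] for all [x < h(i)], pass
    to a subset in [X] of this Sigma^0_1 set and bound the witnesses by a
    function of [X].  Otherwise, almost every [i] has some [x < h(i)] with
    [~ R(i, x)], and WKL, through Sigma^0_1 separation, yields [g] in [X] choosing
    such an [x], so that [g] refutes the hypothesis of the collection instance. *)
Require Import Defs.
From Stdlib Require Import Arith Lia Ring Cantor Classical ClassicalEpsilon
  FunctionalExtensionality PropExtensionality.

(** A Skolem function must itself belong to [X], and the means of producing one is a search for the
    least value together with its witness ([Rec_choice]), which requires a Sigma1 relation. This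
    sets the reach of Los' theorem at Sigma1 and shapes the Sigma2 transfer: counterexamples to a
    Pi1 formula failing at every index can be searched for, whereas the truth set of a Pi1 formula
    need not be in [X], so the generic sequence need not decide it. The same obstacle makes one case
    of collection hard: having no witness at all is a Pi1 condition on x, which no search confirms.
    One kind of requirement, [decides_choice], serves both collection in [K] and the ultrafilter
    property: deciding a set of [X] is its instance with bound 1. Much of the development is coding
    demanded by WKL. Its trees use heap numbers, whose levels are delimited by powers of two, while
    the language has only sum and product; hence divisibility codes for finite sets and a recursion
    theorem precede separation. *)

Section Model.

Context {M : arith} {S : Type} (mem : car M -> S -> Prop).

Local Notation V := (car M).
Local Notation "x + y" := (add M x y).
Local Notation "x * y" := (mul M x y).
Local Notation "0" := (zero M).
Local Notation "1" := (one M).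
Local Notation "x < y" := (lt M x y).
(** As a strict bound below the successor, [<=] is literally a bound of [fbex] or [fball], so one
    clause per quantifier covers both orders; [lt_succ] is then literally a basic axiom. *)
Local Notation "x <= y" := (lt M x (add M y (one M))).

Context (Hbasic : basic_axioms M) (Hind : Sigma1_induction M S mem)
  (Hca : Delta1_comprehension M S mem) (Hcol : BSigma M S mem 2)
  (Hwkl : WKL M S mem)
  (e0 : nat -> V) (He0 : forall m, exists n, e0 n = m)
  (se0 : nat -> S) (Hse0 : forall Y, exists n, se0 n = Y).

(* Enumerating all elements in the tail [e0] of every environment turns parameters
   into variables, so the classes below are closed under connectives and bounded
   quantifiers without any renaming of variables. *)
Fixpoint env (k : nat) (e : nat -> V) : nat -> V :=
  match k with
  | O => e0
  | Datatypes.S k => scons (e O) (env k (fun n => e (Datatypes.S n)))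
  end.

Definition defT (k : nat) (T : (nat -> V) -> V) : Prop :=
  exists t, forall e, T e = teval M (env k e) t.

Definition defD0 (k : nat) (P : (nat -> V) -> Prop) : Prop :=
  exists phi, isD0 phi /\ forall e, P e <-> sat M S mem phi (env k e) se0.

Lemma env_lt k : forall i e, (i < k)%nat -> env k e i = e i.
Proof.
induction k as [|k IH]; intros i e Hi; [lia|].
destruct i as [|i]; simpl; [reflexivity|].
rewrite IH by lia. reflexivity.
Qed.

Lemma env_ge k : forall i e, env k e (k + i)%nat = e0 i.
Proof.
induction k as [|k IH]; intros i e; simpl; [reflexivity|apply IH].
Qed.

Lemma defT_var k i : (i < k)%nat -> defT k (fun e => e i).
Proof. intros Hi; exists (tvar i); intros e; simpl; now rewrite env_lt. Qed.

Lemma defT_const k c : defT k (fun _ => c).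
Proof.
destruct (He0 c) as [n Hn]. exists (tvar (k + n)); intros e; simpl.
now rewrite env_ge.
Qed.

Lemma defT_add k T U : defT k T -> defT k U -> defT k (fun e => T e + U e).
Proof.
intros [t Ht] [u Hu]; exists (tadd t u); intros e; simpl; now rewrite Ht, Hu.
Qed.

Lemma defT_mul k T U : defT k T -> defT k U -> defT k (fun e => T e * U e).
Proof.
intros [t Ht] [u Hu]; exists (tmul t u); intros e; simpl; now rewrite Ht, Hu.
Qed.

Lemma defD0_eq k T U : defT k T -> defT k U -> defD0 k (fun e => T e = U e).
Proof.
intros [t Ht] [u Hu]; exists (feq t u); split; [constructor|].
intros e; simpl; now rewrite Ht, Hu.
Qed.

Lemma defD0_lt k T U : defT k T -> defT k U -> defD0 k (fun e => T e < U e).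
Proof.
intros [t Ht] [u Hu]; exists (flt t u); split; [constructor|].
intros e; simpl; now rewrite Ht, Hu.
Qed.

Lemma defD0_mem k T Y : defT k T -> defD0 k (fun e => mem (T e) Y).
Proof.
intros [t Ht]; destruct (Hse0 Y) as [n Hn]; exists (fmem t n).
split; [constructor|]. intros e; simpl; now rewrite Ht, Hn.
Qed.

Lemma defD0_not k P : defD0 k P -> defD0 k (fun e => ~ P e).
Proof.
intros [p [Hp Ep]]; exists (fneg p); split; [now constructor|].
intros e; simpl; now rewrite Ep.
Qed.

Lemma defD0_and k P Q : defD0 k P -> defD0 k Q -> defD0 k (fun e => P e /\ Q e).
Proof.
intros [p [Hp Ep]] [q [Hq Eq]]; exists (fand p q); split; [now constructor|].
intros e; simpl; now rewrite Ep, Eq.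
Qed.

Lemma defD0_or k P Q : defD0 k P -> defD0 k Q -> defD0 k (fun e => P e \/ Q e).
Proof.
intros [p [Hp Ep]] [q [Hq Eq]]; exists (for_ p q); split; [now constructor|].
intros e; simpl; now rewrite Ep, Eq.
Qed.

Lemma defD0_imp k P Q : defD0 k P -> defD0 k Q -> defD0 k (fun e => P e -> Q e).
Proof.
intros [p [Hp Ep]] [q [Hq Eq]]; exists (fimp p q); split; [now constructor|].
intros e; simpl; now rewrite Ep, Eq.
Qed.

Lemma defD0_iff k P Q : defD0 k P -> defD0 k Q -> defD0 k (fun e => P e <-> Q e).
Proof.
intros HP HQ; unfold iff; apply defD0_and; now apply defD0_imp.
Qed.

Lemma defD0_bex k T (Q : V -> (nat -> V) -> Prop) :
  defT k T ->
  defD0 (Datatypes.S k) (fun e => Q (e O) (fun n => e (Datatypes.S n))) ->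
  defD0 k (fun e => exists a, a < T e /\ Q a e).
Proof.
intros [t Ht] [p [Hp Ep]]; exists (fbex t p); split; [now constructor|].
intros e; simpl; rewrite Ht.
split; intros [a [H1 H2]]; exists a; split; auto; now apply (Ep (scons a e)).
Qed.

Lemma defD0_ball k T (Q : V -> (nat -> V) -> Prop) :
  defT k T ->
  defD0 (Datatypes.S k) (fun e => Q (e O) (fun n => e (Datatypes.S n))) ->
  defD0 k (fun e => forall a, a < T e -> Q a e).
Proof.
intros [t Ht] [p [Hp Ep]]; exists (fball t p); split; [now constructor|].
intros e; simpl; rewrite Ht.
split; intros H a H1; specialize (H a H1); now apply (Ep (scons a e)).
Qed.

(** A term of the language, with no halving as in Cantor's pairing. The value lies between the
    squares of x + y and x + y + 1, so it determines x + y and then x. *)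
Definition pair (x y : V) : V := (x + y) * (x + y) + x.

Lemma defT_pair k T U : defT k T -> defT k U -> defT k (fun e => pair (T e) (U e)).
Proof.
intros; unfold pair; apply (defT_add _ (fun e => (T e + U e) * (T e + U e)) T);
  [apply (defT_mul _ (fun e => T e + U e) (fun e => T e + U e)); apply defT_add|];
  assumption.
Qed.

Ltac d0 := cbv beta; first [assumption | lazymatch goal with
  | |- defT _ (fun _ => ?c) => apply defT_const
  | |- defT _ (fun e => e _) => apply defT_var; lia
  | |- defT _ (fun e => @?T e + @?U e) => apply (defT_add _ T U); d0
  | |- defT _ (fun e => @?T e * @?U e) => apply (defT_mul _ T U); d0
  | |- defT _ (fun e => pair (@?T e) (@?U e)) => apply (defT_pair _ T U); d0
  | |- defD0 _ (fun e => @?T e = @?U e) => apply (defD0_eq _ T U); d0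
  | |- defD0 _ (fun e => (@?T e) < (@?U e)) => apply (defD0_lt _ T U); d0
  | |- defD0 _ (fun e => mem (@?T e) ?Y) => apply (defD0_mem _ T Y); d0
  | |- defD0 _ (fun e => ~ @?P e) => apply (defD0_not _ P); d0
  | |- defD0 _ (fun e => @?P e /\ @?Q e) => apply (defD0_and _ P Q); d0
  | |- defD0 _ (fun e => @?P e \/ @?Q e) => apply (defD0_or _ P Q); d0
  | |- defD0 _ (fun e => @?P e <-> @?Q e) => apply (defD0_iff _ P Q); d0
  | |- defD0 _ (fun e => forall a, a < @?T e -> @?Q e a) =>
      apply (defD0_ball _ T (fun a e => Q e a)); d0
  | |- defD0 _ (fun e => exists a, a < @?T e /\ @?Q e a) =>
      apply (defD0_bex _ T (fun a e => Q e a)); d0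
  | |- defD0 _ (fun e => @?P e -> @?Q e) => apply (defD0_imp _ P Q); d0
  end].

Lemma ind_Sigma1 (Q : V -> V -> Prop) :
  defD0 2 (fun e => Q (e O) (e 1%nat)) ->
  (exists w, Q w 0) ->
  (forall n, (exists w, Q w n) -> exists w, Q w (n + 1)) ->
  forall n, exists w, Q w n.
Proof.
intros [p [Hp Ep]] H0 Hs n.
assert (HE : forall n, (exists w, Q w n) <-> sat M S mem (fex p) (scons n e0) se0).
{ intros m; simpl; split; intros [w Hw]; exists w;
  apply (Ep (scons w (scons m e0))); exact Hw. }
apply HE. apply Hind.
- apply SigEx, SigPi, Pi0, Hp.
- now apply HE.
- intros m Hm; apply HE, Hs, HE, Hm.
Qed.

Lemma ind_D0 (P : V -> Prop) :
  defD0 2 (fun e => P (e 1%nat)) ->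
  P 0 -> (forall n, P n -> P (n + 1)) -> forall n, P n.
Proof.
intros HP H0 Hs n.
destruct (ind_Sigma1 (fun _ n => P n) HP) with (n := n) as [_ H]; auto.
- now exists 0.
- intros m [_ Hm]; exists 0; auto.
Qed.

(** * Arithmetic *)

Lemma succ_neq_0 n : n + 1 <> 0. Proof. apply Hbasic. Qed.
Lemma succ_inj m n : m + 1 = n + 1 -> m = n. Proof. apply Hbasic. Qed.
Lemma add_0_r m : m + 0 = m. Proof. apply Hbasic. Qed.
Lemma add_succ_r m n : m + (n + 1) = (m + n) + 1. Proof. apply Hbasic. Qed.
Lemma mul_0_r m : m * 0 = 0. Proof. apply Hbasic. Qed.
Lemma mul_succ_r m n : m * (n + 1) = m * n + m. Proof. apply Hbasic. Qed.
Lemma nlt_0 m : ~ m < 0. Proof. apply Hbasic. Qed.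
Lemma lt_succ m n : m <= n <-> (m < n \/ m = n). Proof. apply Hbasic. Qed.
Lemma zero_or_succ n : n = 0 \/ exists m, n = m + 1. Proof. apply Hbasic. Qed.

Lemma add_0_l n : 0 + n = n.
Proof.
revert n; apply ind_D0; [d0|apply add_0_r|].
intros n IH; now rewrite add_succ_r, IH.
Qed.

Lemma add_succ_l m n : (m + 1) + n = (m + n) + 1.
Proof.
revert n; apply ind_D0; [d0|now rewrite !add_0_r|].
intros n IH; now rewrite !add_succ_r, IH.
Qed.

Lemma add_comm m n : m + n = n + m.
Proof.
revert n; apply ind_D0; [d0|now rewrite add_0_r, add_0_l|].
intros n IH; now rewrite add_succ_r, add_succ_l, IH.
Qed.

Lemma add_assoc m n p : m + (n + p) = (m + n) + p.
Proof.
revert p; apply ind_D0; [d0|now rewrite !add_0_r|].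
intros p IH; now rewrite !add_succ_r, IH.
Qed.

Lemma mul_0_l n : 0 * n = 0.
Proof.
revert n; apply ind_D0; [d0|apply mul_0_r|].
intros n IH; now rewrite mul_succ_r, IH, add_0_r.
Qed.

Lemma mul_succ_l m n : (m + 1) * n = m * n + n.
Proof.
revert n; apply ind_D0; [d0|now rewrite !mul_0_r, add_0_r|].
intros n IH. rewrite !mul_succ_r, IH, <- !add_assoc. f_equal.
now rewrite !add_succ_r, (add_comm n m).
Qed.

Lemma mul_comm m n : m * n = n * m.
Proof.
revert n; apply ind_D0; [d0|now rewrite mul_0_r, mul_0_l|].
intros n IH; now rewrite mul_succ_r, mul_succ_l, IH.
Qed.

Lemma mul_add_l m n p : (m + n) * p = m * p + n * p.
Proof.
revert p; apply ind_D0; [d0|now rewrite !mul_0_r, add_0_r|].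
intros p IH. rewrite !mul_succ_r, IH, <- !add_assoc. f_equal.
rewrite !add_assoc. now rewrite (add_comm (n * p) m).
Qed.

Lemma mul_assoc m n p : m * (n * p) = (m * n) * p.
Proof.
revert p; apply ind_D0; [d0|now rewrite !mul_0_r|].
intros p IH. rewrite !mul_succ_r, (mul_comm m (n * p + n)), mul_add_l.
now rewrite <- IH, (mul_comm m n), (mul_comm m (n * p)).
Qed.

Lemma mul_1_l n : 1 * n = n.
Proof.
rewrite mul_comm, <- (add_0_l 1), mul_succ_r, mul_0_r. apply add_0_l.
Qed.

Lemma M_semiring : semi_ring_theory 0 1 (add M) (mul M) (@eq V).
Proof.
constructor; intros.
- apply add_0_l.
- apply add_comm.
- apply add_assoc.
- apply mul_1_l.
- apply mul_0_l.
- apply mul_comm.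
- apply mul_assoc.
- apply mul_add_l.
Qed.

Add Ring M_ring : M_semiring.

Lemma lt_add_succ a c : a < a + c + 1.
Proof.
revert c; apply ind_D0; [d0| |].
- apply lt_succ; right; ring.
- intros c IH. replace (a + (c + 1)) with (a + c + 1) by ring.
  apply lt_succ; now left.
Qed.

Lemma lt_iff a b : a < b <-> exists c, b = a + c + 1.
Proof.
split.
(* The implication is placed under the quantifier, so that the induction formula is Sigma1. *)
- revert b. assert (H : forall b, exists c, a < b -> b = a + c + 1).
  { apply ind_Sigma1; [d0| |].
    - exists 0; intros H; now apply nlt_0 in H.
    - intros b [c Hc]. destruct (classic (a < b)) as [Hab|Hab].
      + exists (c + 1); intros _. rewrite (Hc Hab) at 1; ring.
      + exists 0; intros H; apply lt_succ in H as [H|H]; [tauto|]. subst; ring. }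
  intros b Hb; destruct (H b) as [c Hc]; exists c; auto.
- intros [c ->]; apply lt_add_succ.
Qed.

Lemma le_iff a b : a <= b <-> exists c, b = a + c.
Proof.
rewrite lt_iff; split; intros [c Hc]; exists c; [now apply succ_inj|now rewrite Hc].
Qed.

Lemma add_cancel_r a b c : a + c = b + c -> a = b.
Proof.
revert c; apply (ind_D0 (fun c => a + c = b + c -> a = b)); [d0| |].
- now rewrite !add_0_r.
- intros c IH H; apply IH, succ_inj. now rewrite <- !add_assoc.
Qed.

Lemma add_cancel_l a b c : c + a = c + b -> a = b.
Proof. rewrite !(add_comm c); apply add_cancel_r. Qed.

Lemma lt_irrefl a : ~ a < a.
Proof.
rewrite lt_iff; intros [c Hc]. apply (succ_neq_0 c).
apply (add_cancel_l _ _ a). rewrite Hc at 2; ring.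
Qed.

Lemma lt_trans a b c : a < b -> b < c -> a < c.
Proof.
rewrite !lt_iff; intros [x ->] [y ->]; exists (x + y + 1); ring.
Qed.

Lemma le_lt_trans a b c : a <= b -> b < c -> a < c.
Proof.
rewrite lt_succ; intros [H| ->] ?; [now apply (lt_trans _ b)|assumption].
Qed.

Lemma lt_le_trans a b c : a < b -> b <= c -> a < c.
Proof.
rewrite (lt_succ b); intros ? [H| <-]; [now apply (lt_trans _ b)|assumption].
Qed.

Lemma lt_le a b : a < b -> a <= b.
Proof. intros; apply lt_succ; now left. Qed.

Lemma le_refl a : a <= a.
Proof. apply lt_succ; now right. Qed.

Lemma le_trans a b c : a <= b -> b <= c -> a <= c.
Proof. rewrite !le_iff; intros [x ->] [y ->]; exists (x + y); ring. Qed.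

Lemma le_0_l a : 0 <= a.
Proof. apply le_iff; exists a; ring. Qed.

Lemma succ_le_iff a b : a + 1 <= b <-> a < b.
Proof.
rewrite le_iff, lt_iff; split; intros [c ->]; exists c; ring.
Qed.

Lemma succ_lt_mono a b : a < b <-> a + 1 < b + 1.
Proof. symmetry; apply succ_le_iff. Qed.

Lemma le_total a b : a <= b \/ b < a.
Proof.
revert a; apply (ind_D0 (fun a => a <= b \/ b < a)); [d0| |].
- left; apply le_0_l.
- intros a [H|H].
  + apply lt_succ in H as [H| ->].
    * left; now apply succ_le_iff.
    * right; apply le_refl.
  + right; now apply lt_le.
Qed.

Lemma nle_lt a b : ~ a <= b <-> b < a.
Proof.
split.
- intros H; destruct (le_total a b); tauto.
- intros H H'. apply (lt_irrefl b). now apply (lt_le_trans _ a).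
Qed.

Lemma nlt_le a b : ~ a < b <-> b <= a.
Proof.
rewrite <- nle_lt; split; [apply NNPP|tauto].
Qed.

Lemma le_antisym a b : a <= b -> b <= a -> a = b.
Proof.
rewrite lt_succ; intros [H| ->] H'; [|reflexivity].
exfalso; revert H; now apply nlt_le.
Qed.

Lemma lt_total a b : a < b \/ a = b \/ b < a.
Proof.
destruct (le_total a b) as [H|H]; [|tauto]. apply lt_succ in H; tauto.
Qed.

Lemma le_add_r a b : a <= a + b.
Proof. apply le_iff; now exists b. Qed.

Lemma le_add_l a b : a <= b + a.
Proof. rewrite (add_comm b); apply le_add_r. Qed.

Lemma add_le_mono a b c d : a <= b -> c <= d -> a + c <= b + d.
Proof. rewrite !le_iff; intros [x ->] [y ->]; exists (x + y); ring. Qed.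

Lemma add_lt_mono_r a b c : a < b <-> a + c < b + c.
Proof.
rewrite !lt_iff; split; intros [x H]; exists x.
- rewrite H; ring.
- apply (add_cancel_r _ _ c); rewrite H; ring.
Qed.

Lemma add_lt_le_mono a b c d : a < b -> c <= d -> a + c < b + d.
Proof. rewrite le_iff, !lt_iff; intros [x ->] [y ->]; exists (x + y); ring. Qed.

Lemma mul_le_mono a b c d : a <= b -> c <= d -> a * c <= b * d.
Proof.
rewrite !le_iff; intros [x ->] [y ->]; exists (a * y + x * c + x * y); ring.
Qed.

Lemma double_lt a b : a < b -> a + a < b + b.
Proof. rewrite !lt_iff; intros [x ->]; exists (x + x + 1); ring. Qed.

Lemma double_lt_inv a b : a + a < b + b -> a < b.
Proof.
intros H; apply nle_lt; intros H'. revert H; apply nlt_le; now apply add_le_mono.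
Qed.

Lemma even_or_odd n : exists h, n = h + h \/ n = h + h + 1.
Proof.
revert n; apply ind_Sigma1; [d0| |].
- exists 0; left; ring.
- intros n [h [-> | ->]]; [exists h; now right|exists (h + 1); left; ring].
Qed.

Lemma double_inj a b : a + a = b + b -> a = b.
Proof.
intros H; destruct (lt_total a b) as [L|[E|L]]; [|exact E|];
  apply double_lt in L; rewrite H in L; now apply lt_irrefl in L.
Qed.

Lemma even_not_odd a b : a + a <> b + b + 1.
Proof.
intros H. destruct (le_total a b) as [L|L].
- apply (lt_irrefl (b + b + 1)). rewrite <- H at 1.
  apply add_le_mono; assumption.
- apply lt_iff in L as [c ->]. apply (succ_neq_0 (c + c)).
  apply (add_cancel_l _ _ (b + b + 1)). rewrite add_0_r.
  transitivity (b + c + 1 + (b + c + 1)); [ring|exact H].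
Qed.

(** * Pairing and Sigma1-definable predicates and functions *)

Lemma pair_inj x y x' y' : pair x y = pair x' y' -> x = x' /\ y = y'.
Proof.
assert (L : forall x y x' y', x + y < x' + y' -> pair x y < pair x' y').
{ clear x y x' y'; intros x y x' y' H. unfold pair.
  apply (lt_le_trans _ ((x' + y') * (x' + y'))); [|apply le_add_r].
  apply lt_iff in H as [c Hc]; rewrite Hc. apply lt_iff.
  exists (y + (x + y) * (c + c + 1) + c * c + c + c).
  ring. }
intros H. destruct (lt_total (x + y) (x' + y')) as [C|[C|C]].
- apply L in C; rewrite H in C; now apply lt_irrefl in C.
- unfold pair in H; rewrite C in H; apply add_cancel_l in H; subst.
  split; [reflexivity|now apply add_cancel_l in C].
- apply L in C; rewrite H in C; now apply lt_irrefl in C.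
Qed.

Lemma pair_le_l x y : x <= pair x y.
Proof. apply le_add_l. Qed.

Lemma pair_le_r x y : y <= pair x y.
Proof.
unfold pair. apply (le_trans _ ((x + y) * (x + y))); [|apply le_add_r].
destruct (zero_or_succ y) as [-> |[z ->]]; [apply le_0_l|].
apply le_iff. exists (x * (x + z + z + 1 + 1) + z * (z + 1)). ring.
Qed.

(* [pair] is not surjective: the projections of a non-pair are both [0]. *)
Definition unpair (z x y : V) : Prop :=
  z = pair x y \/ (x = 0 /\ y = 0 /\ forall a, a <= z -> forall b, b <= z -> z <> pair a b).

Lemma unpair_pair x y a b : unpair (pair x y) a b -> a = x /\ b = y.
Proof.
intros [H|(_ & _ & H)].
- apply pair_inj in H; intuition congruence.
- exfalso; apply (H x (pair_le_l x y) y (pair_le_r x y) eq_refl).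
Qed.

Lemma unpair_ex z : exists p : V * V, unpair z (fst p) (snd p).
Proof.
destruct (classic (exists x y, z = pair x y)) as [(x & y & H)|H].
- exists (x, y); now left.
- exists (0, 0); right; repeat split; intros a _ b _ E; apply H; eauto.
Qed.

Definition p1 (z : V) : V := fst (proj1_sig (constructive_indefinite_description _ (unpair_ex z))).
Definition p2 (z : V) : V := snd (proj1_sig (constructive_indefinite_description _ (unpair_ex z))).

Lemma unpair_p z : unpair z (p1 z) (p2 z).
Proof. unfold p1, p2; now destruct constructive_indefinite_description. Qed.

Lemma p1_pair x y : p1 (pair x y) = x.
Proof. apply (unpair_pair x y _ _ (unpair_p _)). Qed.

Lemma p2_pair x y : p2 (pair x y) = y.
Proof. apply (unpair_pair x y _ _ (unpair_p _)). Qed.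

Lemma unpair_iff z x y : unpair z x y <-> x = p1 z /\ y = p2 z.
Proof.
split; [|intros [-> ->]; apply unpair_p].
destruct (unpair_p z) as [E|(E1 & E2 & E)]; intros H.
- rewrite E in H. now apply unpair_pair in H.
- destruct H as [H|(H1 & H2 & _)]; [|split; congruence].
  exfalso; subst z; apply (E x (pair_le_l _ _) y (pair_le_r _ _) eq_refl).
Qed.

Lemma p_le z : p1 z <= z /\ p2 z <= z.
Proof.
destruct (unpair_p z) as [E|(E1 & E2 & _)].
- split; rewrite E at 2; [apply pair_le_l|apply pair_le_r].
- rewrite E1, E2; split; apply le_0_l.
Qed.

Lemma p1_le z : p1 z <= z. Proof. apply p_le. Qed.
Lemma p2_le z : p2 z <= z. Proof. apply p_le. Qed.

(** * Sets of X, Sigma1 predicates and functions of X, with their closure properties *)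

Definition Xset (P : V -> Prop) : Prop := exists Y, forall n, mem n Y <-> P n.
(** A normal form: the Delta0 matrix is replaced by a set of [X], so that all parameters are
    absorbed into [Y] and closure properties only manipulate atomic formulas. *)
Definition Sg (P : V -> Prop) : Prop := exists Y, forall n, P n <-> exists w, mem (pair n w) Y.
Definition Rec (F : V -> V) : Prop := exists Y, forall x y, mem (pair x y) Y <-> y = F x.

Lemma Xset_ext P Q : Xset P -> (forall n, P n <-> Q n) -> Xset Q.
Proof. intros [Y HY] H; exists Y; intros n; now rewrite HY. Qed.

Lemma Sg_ext P Q : Sg P -> (forall n, P n <-> Q n) -> Sg Q.
Proof. intros [Y HY] H; exists Y; intros n; now rewrite <- HY, H. Qed.

Lemma Xset_Delta1 (P : V -> Prop) (Q0 Q1 : V -> V -> Prop) :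
  defD0 2 (fun e => Q0 (e O) (e 1%nat)) -> defD0 2 (fun e => Q1 (e O) (e 1%nat)) ->
  (forall n, P n <-> exists w, Q0 w n) -> (forall n, ~ P n <-> exists w, Q1 w n) ->
  Xset P.
Proof.
intros [f [Hf Ef]] [g [Hg Eg]] HP HN.
assert (E0 : forall n, P n <-> sat M S mem (fex f) (scons n e0) se0).
{ intros n; rewrite HP; simpl; split; intros [w Hw]; exists w;
  apply (Ef (scons w (scons n e0))); exact Hw. }
assert (E1 : forall n, ~ P n <-> ~ sat M S mem (fall (fneg g)) (scons n e0) se0).
{ intros n; rewrite HN; simpl; split.
  - intros [w Hw] H; apply (H w), (Eg (scons w (scons n e0))), Hw.
  - intros H; apply NNPP; intros H'; apply H; intros w Hw; apply H'.
    exists w; apply (Eg (scons w (scons n e0))), Hw. }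
destruct (Hca (fex f) (fall (fneg g))) with (e := e0) (se := se0) as [Y HY].
- apply SigEx, SigPi, Pi0, Hf.
- apply PiAll, PiSig, Sig0, D0neg, Hg.
- intros n; rewrite <- E0. split; intros H; apply NNPP; intros H'; apply E1 in H'; tauto.
- exists Y; intros n; now rewrite HY, <- E0.
Qed.

Lemma Xset_D0 (P : V -> Prop) : defD0 2 (fun e => P (e 1%nat)) -> Xset P.
Proof.
intros HP.
apply (Xset_Delta1 P (fun _ n => P n) (fun _ n => ~ P n)); [d0|d0| |];
  intros n; (split; [now exists 0|now intros [_ H]]).
Qed.

(** The depth 4 is where [Q] lands in the proof, below the two bounded quantifiers that split the
    coded pair. The depths 6 in [Rec_intro_D0] and 8 in [Rec_op] arise in the same way. *)
Lemma Sg_intro (P : V -> Prop) (Q : V -> V -> Prop) :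
  defD0 4 (fun e => Q (e O) (e 1%nat)) -> (forall n, P n <-> exists w, Q w n) -> Sg P.
Proof.
intros HQ HP.
destruct (Xset_D0 (fun z => exists n, n <= z /\ exists w, w <= z /\ z = pair n w /\ Q w n))
  as [Y HY]; [d0|].
exists Y; intros n; rewrite HP; split; intros [w Hw]; exists w.
- apply HY. exists n; split; [apply pair_le_l|]; exists w; split; [apply pair_le_r|].
  auto.
- apply HY in Hw as (n' & _ & w' & _ & E & Hw). now apply pair_inj in E as [-> ->].
Qed.

Lemma Xset_Sg P : Xset P -> Sg P.
Proof.
intros [Y HY]; apply (Sg_intro P (fun _ n => mem n Y)); [d0|].
intros n; rewrite <- HY; split; [now exists 0|now intros [_ H]].
Qed.

Lemma Xset_of_Sg P : Sg P -> Sg (fun n => ~ P n) -> Xset P.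
Proof.
intros [Y HY] [Z HZ].
apply (Xset_Delta1 P (fun w n => mem (pair n w) Y) (fun w n => mem (pair n w) Z));
  [d0|d0|exact HY|exact HZ].
Qed.

Lemma Xset_not P : Xset P -> Xset (fun n => ~ P n).
Proof.
intros [Y HY]; apply (Xset_ext (fun n => ~ mem n Y)); [apply Xset_D0; d0|].
intros n; now rewrite HY.
Qed.

Lemma Xset_and P Q : Xset P -> Xset Q -> Xset (fun n => P n /\ Q n).
Proof.
intros [Y HY] [Z HZ]; apply (Xset_ext (fun n => mem n Y /\ mem n Z)); [apply Xset_D0; d0|].
intros n; now rewrite HY, HZ.
Qed.

Lemma Xset_or P Q : Xset P -> Xset Q -> Xset (fun n => P n \/ Q n).
Proof.
intros [Y HY] [Z HZ]; apply (Xset_ext (fun n => mem n Y \/ mem n Z)); [apply Xset_D0; d0|].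
intros n; now rewrite HY, HZ.
Qed.

Lemma Xset_imp P Q : Xset P -> Xset Q -> Xset (fun n => P n -> Q n).
Proof.
intros [Y HY] [Z HZ]; apply (Xset_ext (fun n => mem n Y -> mem n Z)); [apply Xset_D0; d0|].
intros n; now rewrite HY, HZ.
Qed.

Lemma Xset_iff P Q : Xset P -> Xset Q -> Xset (fun n => P n <-> Q n).
Proof. intros; unfold iff; apply Xset_and; now apply Xset_imp. Qed.

Lemma Xset_const (P : Prop) : Xset (fun _ => P).
Proof.
destruct (classic P) as [H|H].
- apply (Xset_ext (fun _ => 0 = 0)); [apply Xset_D0; d0|].
  intros _; split; [auto|reflexivity].
- apply (Xset_ext (fun _ => ~ 0 = 0)); [apply Xset_D0; d0|].
  intros _; split; [intros N; now elim N|tauto].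
Qed.

Lemma Xset_mem Y : Xset (fun n => mem n Y).
Proof. now exists Y. Qed.

(** A total function with a Sigma1 graph has a Delta1 graph: [y] differs from [F x] exactly if some
    other number is [F x]. Numbers that are not pairs go to the complement. *)
Lemma Rec_intro F : Sg (fun z => p2 z = F (p1 z)) -> Rec F.
Proof.
intros [Y HY].
assert (HY' : forall x y, y = F x <-> exists w, mem (pair (pair x y) w) Y).
{ intros x y; rewrite <- HY, p1_pair, p2_pair; tauto. }
destruct (Xset_Delta1 (fun z => exists x, x <= z /\ exists y, y <= z /\ z = pair x y /\ y = F x)
  (fun w z => exists x, x <= z /\ exists y, y <= z /\ z = pair x y /\ mem (pair z w) Y)
  (fun w z => ~ (exists x, x <= z /\ exists y, y <= z /\ z = pair x y) \/
     exists x, x <= z /\ exists y, y <= z /\ z = pair x y /\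
     exists y', y' <= w /\ exists v, v <= w /\ w = pair y' v /\ y' <> y /\
       mem (pair (pair x y') v) Y)) as [Z HZ].
- d0.
- d0.
- intros z; split.
  + intros (x & Hx & y & Hy & -> & E). apply HY' in E as [w Hw].
    exists w, x; split; [assumption|]; exists y; auto.
  + intros (w & x & Hx & y & Hy & -> & Hw).
    exists x; split; [assumption|]; exists y; repeat split; auto. apply HY'; eauto.
- intros z; split.
  + intros H. destruct (classic (exists x, x <= z /\ exists y, y <= z /\ z = pair x y))
      as [(x & Hx & y & Hy & E)|N]; [|exists 0; now left].
    destruct (proj1 (HY' x (F x)) eq_refl) as [v Hv].
    exists (pair (F x) v); right. exists x; split; [assumption|].
    exists y; repeat split; auto. exists (F x); split; [apply pair_le_l|].
    exists v; split; [apply pair_le_r|]. repeat split; auto.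
    intros E'; apply H. exists x; split; auto; exists y; auto.
  + intros (w & [N|(x & Hx & y & Hy & E & y' & _ & v & _ & _ & Hn & Hm)])
      (x1 & Hx1 & y1 & Hy1 & E1 & E2).
    * apply N; exists x1; split; [assumption|]; now exists y1.
    * rewrite E in E1; apply pair_inj in E1 as [-> ->].
      apply Hn. rewrite E2; apply HY'; eauto.
- exists Z; intros x y; rewrite HZ; split.
  + intros (x1 & _ & y1 & _ & E & H); now apply pair_inj in E as [-> ->].
  + intros E; exists x; split; [apply pair_le_l|].
    exists y; split; [apply pair_le_r|]; auto.
Qed.

Lemma Rec_intro_D0 F (Q : V -> V -> V -> Prop) :
  defD0 6 (fun e => Q (e 2%nat) (e O) (e 1%nat)) ->
  (forall x y, y = F x <-> exists w, Q w y x) -> Rec F.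
Proof.
intros HQ H. apply Rec_intro.
apply (Sg_intro _ (fun w z => exists x, x <= z /\ exists y, y <= z /\ unpair z x y /\
   Q w y x)); [unfold unpair; d0|].
intros z; rewrite H; split.
- intros [w Hw]; exists w, (p1 z). split; [apply p1_le|]. exists (p2 z).
  split; [apply p2_le|]. split; [apply unpair_p|assumption].
- intros (w & x & _ & y & _ & E & Hw); exists w.
  now apply unpair_iff in E as [-> ->].
Qed.

Lemma Rec_p1 : Rec p1.
Proof.
apply (Rec_intro_D0 _ (fun _ x z => exists y, y <= z /\ unpair z x y)).
{ unfold unpair; d0. }
intros z x; split.
- intros ->; exists 0, (p2 z); split; [apply p2_le|apply unpair_p].
- intros (_ & y & _ & H). now apply unpair_iff in H as [-> _].
Qed.

Lemma Rec_p2 : Rec p2.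
Proof.
apply (Rec_intro_D0 _ (fun _ y z => exists x, x <= z /\ unpair z x y)).
{ unfold unpair; d0. }
intros z y; split.
- intros ->; exists 0, (p1 z); split; [apply p1_le|apply unpair_p].
- intros (_ & x & _ & H). now apply unpair_iff in H as [_ ->].
Qed.

Lemma Rec_id : Rec (fun x => x).
Proof.
apply (Rec_intro_D0 _ (fun _ y x => y = x)); [d0|].
intros x y; split; [now exists 0|now intros [_ H]].
Qed.

Lemma Rec_const c : Rec (fun _ => c).
Proof.
apply (Rec_intro_D0 _ (fun _ y _ => y = c)); [d0|].
intros x y; split; [now exists 0|now intros [_ H]].
Qed.

Lemma Rec_comp F G : Rec F -> Rec G -> Rec (fun x => F (G x)).
Proof.
intros [Y HY] [Z HZ].
apply (Rec_intro_D0 _ (fun w y x => mem (pair x w) Z /\ mem (pair w y) Y)); [d0|].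
intros x y; split.
- intros ->; exists (G x); now rewrite HY, HZ.
- intros [w [H1 H2]]. apply HY in H2; apply HZ in H1; congruence.
Qed.

Lemma Rec_op (op : V -> V -> V) F G :
  defD0 8 (fun e => e 2%nat = op (e 1%nat) (e O)) ->
  Rec F -> Rec G -> Rec (fun x => op (F x) (G x)).
Proof.
intros Hop [Y HY] [Z HZ].
apply (Rec_intro_D0 _ (fun w y x => exists a, a <= w /\ exists b, b <= w /\
  (mem (pair x a) Y /\ mem (pair x b) Z) /\ y = op a b)); [d0|].
intros x y; split.
- intros ->; exists (pair (F x) (G x)), (F x); split; [apply pair_le_l|].
  exists (G x); split; [apply pair_le_r|]. now rewrite HY, HZ.
- intros (w & a & _ & b & _ & [Ha Hb] & ->). apply HY in Ha; apply HZ in Hb; congruence.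
Qed.

Lemma Rec_add F G : Rec F -> Rec G -> Rec (fun x => F x + G x).
Proof. apply Rec_op; d0. Qed.

Lemma Rec_mul F G : Rec F -> Rec G -> Rec (fun x => F x * G x).
Proof. apply Rec_op; d0. Qed.

Lemma Rec_pair F G : Rec F -> Rec G -> Rec (fun x => pair (F x) (G x)).
Proof. apply Rec_op; d0. Qed.

Lemma Sg_comp P F : Sg P -> Rec F -> Sg (fun x => P (F x)).
Proof.
intros [Y HY] [Z HZ].
apply (Sg_intro _ (fun w x => exists a, a <= w /\ exists v, v <= w /\
  mem (pair x a) Z /\ mem (pair a v) Y)); [d0|].
intros x; rewrite HY; split.
- intros [v Hv]; exists (pair (F x) v), (F x); split; [apply pair_le_l|].
  exists v; split; [apply pair_le_r|]. now rewrite HZ.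
- intros (w & a & _ & v & _ & Ha & Hv). apply HZ in Ha as ->; eauto.
Qed.

Lemma Xset_comp P F : Xset P -> Rec F -> Xset (fun x => P (F x)).
Proof.
intros HP HF; apply Xset_of_Sg.
- now apply Sg_comp; [apply Xset_Sg|].
- now apply (Sg_comp (fun x => ~ P x)); [apply Xset_Sg, Xset_not|].
Qed.

Definition Xset2 (R : V -> V -> Prop) : Prop := Xset (fun z => R (p1 z) (p2 z)).
Definition Xset3 (R : V -> V -> V -> Prop) : Prop :=
  Xset (fun z => R (p1 (p1 z)) (p2 (p1 z)) (p2 z)).
Definition Sg2 (R : V -> V -> Prop) : Prop := Sg (fun z => R (p1 z) (p2 z)).

Lemma Xset2_comp R F G : Xset2 R -> Rec F -> Rec G -> Xset (fun x => R (F x) (G x)).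
Proof.
intros HR HF HG.
apply (Xset_ext (fun x => R (p1 (pair (F x) (G x))) (p2 (pair (F x) (G x))))).
- now apply (Xset_comp (fun z => R (p1 z) (p2 z)) (fun x => pair (F x) (G x))); [|apply Rec_pair].
- intros x; now rewrite p1_pair, p2_pair.
Qed.

Lemma Xset3_comp R F G H :
  Xset3 R -> Rec F -> Rec G -> Rec H -> Xset (fun x => R (F x) (G x) (H x)).
Proof.
intros HR HF HG HH.
apply (Xset_ext (fun x => R (p1 (p1 (pair (pair (F x) (G x)) (H x))))
  (p2 (p1 (pair (pair (F x) (G x)) (H x)))) (p2 (pair (pair (F x) (G x)) (H x))))).
- now apply (Xset_comp (fun z => R (p1 (p1 z)) (p2 (p1 z)) (p2 z))
    (fun x => pair (pair (F x) (G x)) (H x)));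
    [|apply Rec_pair; [apply Rec_pair|]].
- intros x; now rewrite !p1_pair, !p2_pair.
Qed.

Lemma Sg2_comp R F G : Sg2 R -> Rec F -> Rec G -> Sg (fun x => R (F x) (G x)).
Proof.
intros HR HF HG.
apply (Sg_ext (fun x => R (p1 (pair (F x) (G x))) (p2 (pair (F x) (G x))))).
- now apply (Sg_comp (fun z => R (p1 z) (p2 z)) (fun x => pair (F x) (G x))); [|apply Rec_pair].
- intros x; now rewrite p1_pair, p2_pair.
Qed.

Lemma Xset_eq F G : Rec F -> Rec G -> Xset (fun x => F x = G x).
Proof.
apply (Xset2_comp (fun x y => x = y)).
apply (Xset_ext (fun z => exists x, x <= z /\ exists y, y <= z /\ unpair z x y /\ x = y)).
- apply Xset_D0; unfold unpair; d0.
- intros z; split.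
  + intros (x & _ & y & _ & E & H); now apply unpair_iff in E as [-> ->].
  + intros E; exists (p1 z); split; [apply p1_le|]. exists (p2 z); split; [apply p2_le|].
    split; [apply unpair_p|assumption].
Qed.

Lemma Xset_lt F G : Rec F -> Rec G -> Xset (fun x => F x < G x).
Proof.
apply (Xset2_comp (fun x y => x < y)).
apply (Xset_ext (fun z => exists x, x <= z /\ exists y, y <= z /\ unpair z x y /\ x < y)).
- apply Xset_D0; unfold unpair; d0.
- intros z; split.
  + intros (x & _ & y & _ & E & H); now apply unpair_iff in E as [-> ->].
  + intros E; exists (p1 z); split; [apply p1_le|]. exists (p2 z); split; [apply p2_le|].
    split; [apply unpair_p|assumption].
Qed.

Lemma Sg_and P Q : Sg P -> Sg Q -> Sg (fun x => P x /\ Q x).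
Proof.
intros [Y HY] [Z HZ].
apply (Sg_intro _ (fun w x => exists a, a <= w /\ exists b, b <= w /\
  mem (pair x a) Y /\ mem (pair x b) Z)); [d0|].
intros x; rewrite HY, HZ; split.
- intros [[a Ha] [b Hb]]; exists (pair a b), a; split; [apply pair_le_l|].
  exists b; split; [apply pair_le_r|]. auto.
- intros (w & a & _ & b & _ & Ha & Hb); eauto.
Qed.

Lemma Sg_or P Q : Sg P -> Sg Q -> Sg (fun x => P x \/ Q x).
Proof.
intros [Y HY] [Z HZ].
apply (Sg_intro _ (fun w x => mem (pair x w) Y \/ mem (pair x w) Z)); [d0|].
intros x; rewrite HY, HZ; split.
- intros [[a Ha]|[b Hb]]; eauto.
- intros [w [H|H]]; eauto.
Qed.

Lemma Sg_ex (R : V -> V -> Prop) :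
  Sg (fun z => R (p1 z) (p2 z)) -> Sg (fun x => exists a, R x a).
Proof.
intros [Y HY].
apply (Sg_intro _ (fun w x => exists a, a <= w /\ exists v, v <= w /\
  mem (pair (pair x a) v) Y)); [d0|].
intros x; split.
- intros [a Ha]. destruct (proj1 (HY (pair x a))) as [v Hv].
  { now rewrite p1_pair, p2_pair. }
  exists (pair a v), a; split; [apply pair_le_l|]. exists v; split; [apply pair_le_r|].
  assumption.
- intros (w & a & _ & v & _ & H). exists a.
  specialize (proj2 (HY (pair x a)) (ex_intro _ v H)). now rewrite p1_pair, p2_pair.
Qed.

(** The instance of [Hcol] for a Delta0 matrix; it supplies the common bound on witnesses used in
    [Sg_ball]. *)
Lemma collection_mem (Y : S) (x a : V) :
  (forall b, b < a -> exists w, mem (pair (pair x b) w) Y) ->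
  exists c, forall b, b < a -> exists w, w < c /\ mem (pair (pair x b) w) Y.
Proof.
assert (HD : defD0 3 (fun e => mem (pair (pair (e 2%nat) (e 1%nat)) (e O)) Y)) by d0.
destruct HD as [f [Hf Ef]].
assert (Hf2 : isSigma 2 f) by now apply SigPi, PiSig, Sig0.
assert (E : forall b w, mem (pair (pair x b) w) Y <->
  sat M S mem f (scons w (scons b (scons x e0))) se0).
{ intros b w; apply (Ef (scons w (scons b (scons x e0)))). }
intros H. destruct (Hcol f Hf2 (scons x e0) se0 a) as [c Hc].
- intros b Hb; destruct (H b Hb) as [w Hw]; exists w; now apply E.
- exists c; intros b Hb; destruct (Hc b Hb) as (w & Hw & Hm); exists w.
  split; [assumption|]. now apply E.
Qed.

(** One bound [c] for all witnesses, obtained by collection, becomes the outer witness and leaves a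
    Delta0 matrix. *)
Lemma Sg_ball (T : V -> V) (R : V -> V -> Prop) :
  Rec T -> Sg (fun z => R (p1 z) (p2 z)) -> Sg (fun x => forall a, a < T x -> R x a).
Proof.
intros [Z HZ] [Y HY].
apply (Sg_intro _ (fun w x => exists t, t <= w /\ exists c, c <= w /\ mem (pair x t) Z /\
  forall b, b < t -> exists v, v < c /\ mem (pair (pair x b) v) Y)); [d0|].
assert (HY' : forall x a, R x a <-> exists v, mem (pair (pair x a) v) Y).
{ intros x a; now rewrite <- HY, p1_pair, p2_pair. }
intros x; split.
- intros H. destruct (collection_mem Y x (T x)) as [c Hc].
  { intros b Hb; apply HY', H, Hb. }
  exists (pair (T x) c), (T x); split; [apply pair_le_l|].
  exists c; split; [apply pair_le_r|]. split; [now apply HZ|assumption].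
- intros (w & t & _ & c & _ & Ht & H) a Ha; apply HZ in Ht as ->.
  destruct (H a Ha) as (v & _ & Hv); apply HY'; eauto.
Qed.

(** The predicate is Sigma1 by [Sg_ex] and its complement is Sigma1 by [Sg_ball]. *)
Lemma Xset_bex (T : V -> V) (R : V -> V -> Prop) :
  Rec T -> Xset (fun z => R (p1 z) (p2 z)) -> Xset (fun x => exists a, a < T x /\ R x a).
Proof.
intros HT HR; apply Xset_of_Sg.
- apply (Sg_ex (fun x a => a < T x /\ R x a)), Xset_Sg, Xset_and; [|assumption].
  apply Xset_lt; [apply Rec_p2|apply (Rec_comp T); [assumption|apply Rec_p1]].
- apply (Sg_ext (fun x => forall a, a < T x -> ~ R x a)).
  + apply (Sg_ball T (fun x a => ~ R x a)); [assumption|]. now apply Xset_Sg, Xset_not.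
  + intros x; split; [|intros H a Ha HR'; apply H; eauto].
    intros H (a & Ha & HR'); now apply (H a).
Qed.

Lemma Xset_ball (T : V -> V) (R : V -> V -> Prop) :
  Rec T -> Xset (fun z => R (p1 z) (p2 z)) -> Xset (fun x => forall a, a < T x -> R x a).
Proof.
intros HT HR; apply (Xset_ext (fun x => ~ exists a, a < T x /\ ~ R x a)).
- apply Xset_not, (Xset_bex T (fun x a => ~ R x a)); [assumption|].
  now apply Xset_not.
- intros x; split; [|intros H (a & Ha & N); auto].
  intros H a Ha; apply NNPP; eauto.
Qed.

Ltac rec := cbv beta; first [assumption | lazymatch goal with
  | |- Rec (fun _ => ?c) => apply Rec_const
  | |- Rec (fun x => x) => apply Rec_id
  | |- Rec (fun x => @?F x + @?G x) => apply (Rec_add F G); rec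
  | |- Rec (fun x => @?F x * @?G x) => apply (Rec_mul F G); rec
  | |- Rec (fun x => pair (@?F x) (@?G x)) => apply (Rec_pair F G); rec
  | |- Rec p1 => apply Rec_p1
  | |- Rec p2 => apply Rec_p2
  | |- Rec (fun x => ?F (@?G x)) => apply (Rec_comp F G); rec
  end].

(** Named relations are closed by [assumption], so proofs first put facts such as [Xset2_dvd] into
    the context. *)
Ltac xset := cbv beta; first [assumption | lazymatch goal with
  | |- Xset2 _ => unfold Xset2; xset
  | |- Xset3 _ => unfold Xset3; xset
  | |- Xset (fun _ => ?P) => apply Xset_const
  | |- Xset (fun x => @?F x = @?G x) => apply (Xset_eq F G); rec
  | |- Xset (fun x => (@?F x) < (@?G x)) => apply (Xset_lt F G); rec
  | |- Xset (fun x => mem (@?F x) ?Y) =>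
      apply (Xset_comp (fun n => mem n Y) F); [apply Xset_mem|rec]
  | |- Xset (fun x => ~ @?P x) => apply (Xset_not P); xset
  | |- Xset (fun x => @?P x /\ @?Q x) => apply (Xset_and P Q); xset
  | |- Xset (fun x => @?P x \/ @?Q x) => apply (Xset_or P Q); xset
  | |- Xset (fun x => @?P x <-> @?Q x) => apply (Xset_iff P Q); xset
  | |- Xset (fun x => forall a, a < @?T x -> @?Q x a) =>
      apply (Xset_ball T Q); [rec|xset]
  | |- Xset (fun x => exists a, a < @?T x /\ @?Q x a) =>
      apply (Xset_bex T Q); [rec|xset]
  | |- Xset (fun x => @?P x -> @?Q x) => apply (Xset_imp P Q); xset
  | |- Xset (fun x => ?R (@?F x) (@?G x) (@?H x)) =>
      apply (Xset3_comp R F G H); [assumption|rec|rec|rec]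
  | |- Xset (fun x => ?R (@?F x) (@?G x)) => apply (Xset2_comp R F G); [assumption|rec|rec]
  | |- Xset (fun x => ?P (@?F x)) => apply (Xset_comp P F); [assumption|rec]
  end].

(** [xset] is tried first: negations and implications are allowed only inside parts that are sets of
    [X]. *)
Ltac sg := cbv beta; first [assumption | solve [apply Xset_Sg; xset] | lazymatch goal with
  | |- Sg2 _ => unfold Sg2; sg
  | |- Sg (fun x => @?P x /\ @?Q x) => apply (Sg_and P Q); sg
  | |- Sg (fun x => @?P x \/ @?Q x) => apply (Sg_or P Q); sg
  | |- Sg (fun x => exists a, @?Q x a) => apply (Sg_ex Q); sg
  | |- Sg (fun x => forall a, a < @?T x -> @?Q x a) => apply (Sg_ball T Q); [rec|sg]
  | |- Sg (fun x => ?R (@?F x) (@?G x)) => apply (Sg2_comp R F G); [assumption|rec|rec]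
  | |- Sg (fun x => ?P (@?F x)) => apply (Sg_comp P F); [assumption|rec]
  end].

Lemma ind_Sg (P : V -> Prop) :
  Sg P -> P 0 -> (forall n, P n -> P (n + 1)) -> forall n, P n.
Proof.
intros [Y HY] H0 Hs n. apply HY.
apply (ind_Sigma1 (fun w n => mem (pair n w) Y)); [d0|now apply HY|].
intros m Hm; apply HY, Hs, HY, Hm.
Qed.

Lemma least_Xset (P : V -> Prop) :
  Xset P -> (exists n, P n) -> exists n, P n /\ forall m, m < n -> ~ P m.
Proof.
intros HP [n Hn]. apply NNPP; intros N.
assert (H : forall n, forall m, m < n -> ~ P m).
{ apply (ind_Sg (fun n => forall m, m < n -> ~ P m)); [sg|intros m Hm; now apply nlt_0 in Hm|].
  intros k IH m Hm. apply lt_succ in Hm as [Hm| ->]; [auto|].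
  intros Hk; apply N; now exists k. }
apply (H (n + 1) n (le_refl n) Hn).
Qed.

(* Uniformization: search for the least code of a pair consisting of a value
   and a witness. *)
Lemma Rec_choice (R : V -> V -> Prop) :
  Sg2 R -> (forall x, exists y, R x y) -> exists F, Rec F /\ forall x, R x (F x).
Proof.
intros [Y HY] H.
set (Q := fun x c => mem (pair (pair x (p1 c)) (p2 c)) Y).
assert (HQ : Xset2 Q) by (unfold Q; xset).
assert (E : forall x, exists c, Q x c /\ forall d, d < c -> ~ Q x d).
{ intros x; apply (least_Xset (fun c => Q x c)); [xset|].
  destruct (H x) as [y Hy]. destruct (proj1 (HY (pair x y))) as [w Hw].
  - now rewrite p1_pair, p2_pair.
  - exists (pair y w); unfold Q; now rewrite p1_pair, p2_pair. }
set (c := fun x => proj1_sig (constructive_indefinite_description _ (E x))).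
assert (Hc : forall x, Q x (c x) /\ forall d, d < c x -> ~ Q x d).
{ intros x; unfold c; now destruct constructive_indefinite_description. }
assert (Rc : Rec c).
{ apply Rec_intro, (Sg_ext (fun z => Q (p1 z) (p2 z) /\
    forall d, d < p2 z -> ~ Q (p1 z) d)); [sg|].
  intros z; destruct (Hc (p1 z)) as [H1 H2]; split; [|intros ->; auto].
  intros [H3 H4]. destruct (lt_total (p2 z) (c (p1 z))) as [L|[L|L]]; [|assumption|];
    exfalso; [now apply (H2 (p2 z))|now apply (H4 (c (p1 z)))]. }
exists (fun x => p1 (c x)); split; [rec|].
intros x; destruct (Hc x) as [H1 _]; unfold Q in H1.
specialize (proj2 (HY _) (ex_intro _ _ H1)). now rewrite p1_pair, p2_pair.
Qed.

Lemma Rec_least (R : V -> V -> Prop) :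
  Xset2 R -> (forall x, exists y, R x y) ->
  exists F, Rec F /\ forall x, R x (F x) /\ forall y, y < F x -> ~ R x y.
Proof.
intros HR H. apply (Rec_choice (fun x y => R x y /\ forall z, z < y -> ~ R x z)).
- sg.
- intros x; apply (least_Xset (fun y => R x y)); [xset|auto].
Qed.

(** * Finite set codes and primitive recursion *)

Lemma succ_pos n : 0 < n + 1.
Proof. apply le_0_l. Qed.

Lemma lt_0_1 : 0 < 1.
Proof. rewrite <- (add_0_l 1). apply succ_pos. Qed.

Lemma one_le a : 0 < a -> 1 <= a.
Proof. intros H. apply succ_le_iff in H. now rewrite add_0_l in H. Qed.

(** The bound on the quotient makes divisibility a set of [X]; for a positive divisor it is
    automatic ([dvd_intro]). *)
Definition dvd (x y : V) : Prop := exists k, k <= y /\ y = x * k.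

Lemma Xset2_dvd : Xset2 dvd.
Proof. unfold dvd; xset. Qed.

Lemma dvd_intro x y k : 0 < x -> y = x * k -> dvd x y.
Proof.
intros Hx E; exists k; split; [|assumption].
destruct (zero_or_succ x) as [-> |[z ->]]; [now apply nlt_0 in Hx|].
rewrite E; apply le_iff; exists (z * k); ring.
Qed.

Lemma dvd_mul_r x y z : 0 < x -> dvd x y -> dvd x (y * z).
Proof.
intros Hx [k [_ ->]]; apply (dvd_intro _ _ (k * z)); [assumption|ring].
Qed.

Lemma dvd_add_inv x y z : 0 < x -> dvd x (y + z) -> dvd x y -> dvd x z.
Proof.
intros Hx [k [_ Hk]] [j [_ ->]].
destruct (le_total j k) as [L|L].
- apply le_iff in L as [i ->]. apply (dvd_intro _ _ i); [assumption|].
  apply (add_cancel_l _ _ (x * j)); rewrite Hk; ring.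
(* Here the quotient of the sum is smaller than that of [y], so [z] cannot be positive. *)
- apply (dvd_intro _ _ 0); [assumption|]. rewrite mul_0_r.
  apply le_antisym; [|apply le_0_l]. apply nlt_le; intros Hz.
  apply (lt_irrefl (x * j)). apply (lt_le_trans _ (x * j + z)).
  + rewrite <- (add_0_r (x * j)) at 1. rewrite !(add_comm (x * j)).
    now apply add_lt_mono_r.
  + rewrite Hk. apply mul_le_mono; [apply le_refl|now apply lt_le].
Qed.

(** The moduli of Goedel's beta function. *)
Definition modulus (b v : V) : V := 1 + (v + 1) * b.

Lemma modulus_pos b v : 0 < modulus b v.
Proof. apply lt_iff; exists ((v + 1) * b); unfold modulus; ring. Qed.

(** Modulo [modulus b u] the product (u + 1) * b is -1, so [b] can be cancelled, and with it the
    divisor d + 1 of [b]. *)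
Lemma modulus_cancel a b d u : 
  dvd (d + 1) b -> dvd (modulus b u) (a * ((d + 1) * b)) -> dvd (modulus b u) a.
Proof.
assert (L : forall c, dvd (modulus b u) (c * b) -> dvd (modulus b u) c).
{ intros c H. apply (dvd_add_inv _ (c * b * (u + 1))); [apply modulus_pos| |].
  - apply (dvd_intro _ _ c); [apply modulus_pos|unfold modulus; ring].
  - apply dvd_mul_r; [apply modulus_pos|assumption]. }
intros [w [_ Hw]] H. apply L.
assert (E : a * b = a * (d + 1) * w) by (rewrite Hw; ring). rewrite E.
apply dvd_mul_r; [apply modulus_pos|]. apply L.
now replace (a * (d + 1) * b) with (a * ((d + 1) * b)) by ring.
Qed.

(** Two moduli differ by (d + 1) * b, where d + 1 is the distance of [u] and [v], and this factor
    cancels. Coprimality is phrased as cancellation because the semiring offers neither subtraction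
    nor Bezout coefficients. *)
Lemma modulus_coprime N b a u v :
  (forall d, d < N -> dvd (d + 1) b) -> u < N -> v < N -> u <> v ->
  dvd (modulus b u) (a * modulus b v) -> dvd (modulus b u) a.
Proof.
intros Hb Hu Hv Hn H. destruct (lt_total u v) as [L|[L|L]]; [|tauto|];
  apply lt_iff in L as [d ->]; apply (modulus_cancel a b d).
- apply Hb, (le_lt_trans _ (u + d + 1)); [|assumption]. apply le_iff; exists (u + 1); ring.
- apply (dvd_add_inv _ (a * modulus b u)); [apply modulus_pos| |].
  + replace (a * modulus b u + a * ((d + 1) * b)) with (a * modulus b (u + d + 1))
      by (unfold modulus; ring). assumption.
  + apply (dvd_intro _ _ a); [apply modulus_pos|ring].
- apply Hb, (le_lt_trans _ (v + d + 1)); [|assumption]. apply le_iff; exists (v + 1); ring.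
- apply (dvd_add_inv _ (a * modulus b v)); [apply modulus_pos| |assumption].
  apply (dvd_intro _ _ a); [apply modulus_pos|unfold modulus; ring].
Qed.

(** The factorial of [N] is such a number; induction on its existence avoids having to define the
    factorial function first. *)
Lemma common_multiple N : exists b, 0 < b /\ forall d, d < N -> dvd (d + 1) b.
Proof.
revert N; apply ind_Sg.
- assert (H := Xset2_dvd). apply (Sg_ex (fun N b => 0 < b /\ forall d, d < N -> dvd (d + 1) b)).
  sg.
- exists 1; split; [apply lt_0_1|]. intros d Hd; now apply nlt_0 in Hd.
- intros N (b & Hb & H). exists (b * (N + 1)); split.
  + apply lt_iff in Hb as [c ->]. apply lt_iff; exists (c * N + c + N); ring.
  + assert (P : forall d, 0 < d + 1) by (apply succ_pos).
    intros d Hd; apply lt_succ in Hd as [Hd| ->].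
    * apply dvd_mul_r; auto.
    * apply (dvd_intro _ _ b); [auto|ring].
Qed.

(* A code [s = pair N (pair a b)] stands for the set of those [v < N] for which
   [1 + (v + 1) * b] divides [a]. *)
Definition incode (v s : V) : Prop :=
  v < p1 s /\ dvd (modulus (p2 (p2 s)) v) (p1 (p2 s)).

Lemma Xset2_incode : Xset2 incode.
Proof. assert (H := Xset2_dvd). unfold incode, modulus; xset. Qed.

(** [a] is the product of the moduli of the members of [P] below [N], built by Sigma1 induction on
    [n]. By coprimality, multiplying by the modulus of [n] adds [n] and nothing else. *)
Lemma code_ex (P : V -> Prop) (N : V) :
  Xset P -> exists s, p1 s = N /\ forall v, incode v s <-> (v < N /\ P v).
Proof.
intros HP. destruct (common_multiple N) as (b & Hb & Hd).
assert (H : forall n, exists a, n <= N ->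
  forall v, v < N -> (dvd (modulus b v) a <-> (v < n /\ P v))).
{ apply ind_Sg.
  - assert (H := Xset2_dvd).
    apply (Sg_ex (fun n a => n <= N ->
      forall v, v < N -> (dvd (modulus b v) a <-> (v < n /\ P v)))).
    unfold modulus; sg.
  (* The empty product: since [b] is positive, every modulus exceeds 1 and does not divide 1. *)
  - exists 1; intros _ v Hv; split; [|intros [H _]; now apply nlt_0 in H].
    intros (k & _ & E); exfalso. apply lt_iff in Hb as [c ->].
    destruct (zero_or_succ k) as [-> |[j ->]].
    + rewrite mul_0_r in E. apply (succ_neq_0 0). rewrite add_0_l; exact E.
    + apply (lt_irrefl 1). rewrite E at 2; unfold modulus. apply lt_iff.
      exists ((v * (0 + c) + v + c) + j + j * (v + 1) * (0 + c + 1)). ring.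
  - intros n [a Ha].
    destruct (classic (n < N /\ P n)) as [[Hn HPn]|Hn].
    + exists (a * modulus b n); intros _ v Hv. specialize (Ha (lt_le _ _ Hn) v Hv).
      destruct (classic (v = n)) as [-> |Hvn].
      * split; [intros _; split; [apply le_refl|assumption]|intros _].
        apply (dvd_intro _ _ a); [apply modulus_pos|ring].
      * transitivity (dvd (modulus b v) a).
        { split; [now apply (modulus_coprime N)|]. apply dvd_mul_r, modulus_pos. }
        rewrite Ha, lt_succ; tauto.
    + exists a; intros Hn' v Hv. apply (proj1 (succ_le_iff _ _)) in Hn'.
      rewrite (Ha (lt_le _ _ Hn') v Hv), lt_succ; intuition congruence. }
destruct (H N) as [a Ha]. exists (pair N (pair a b)); split; [apply p1_pair|].
intros v; unfold incode. rewrite !p1_pair, !p2_pair, p1_pair.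
specialize (Ha (le_refl N) v); intuition.
Qed.

(** A computation is a finite set of pairs (argument, value) in which each pair is initial or
    justified by another member ([good]). Functionality is not part of the definition; it follows by
    induction on the argument, also across two computations. *)
Lemma primitive_recursion (G : V -> V) (a0 : V) :
  Rec G -> exists F, Rec F /\ F 0 = a0 /\ forall n, F (n + 1) = G (F n).
Proof.
intros HG. assert (Hin := Xset2_incode).
set (good := fun s => forall v, v < p1 s -> incode v s ->
  (p1 v = 0 /\ p2 v = a0) \/
  exists u, u < p1 s /\ incode u s /\ p1 v = p1 u + 1 /\ p2 v = G (p2 u)).
assert (Hgood : Xset (fun s => good s)) by (unfold good; xset).
assert (step : forall s, good s -> forall v, incode v s ->
  (p1 v = 0 /\ p2 v = a0) \/
  exists u, incode u s /\ p1 v = p1 u + 1 /\ p2 v = G (p2 u)).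
{ intros s Hs v Hv. destruct (Hs v (proj1 Hv) Hv) as [H|(u & _ & H)]; eauto. }
(* The bounds on [v] and [v'] make the induction statement a set of [X]. *)
assert (uniq : forall s s', good s -> good s' -> forall n,
  forall v, v < p1 s -> forall v', v' < p1 s' -> incode v s -> incode v' s' ->
  p1 v = n -> p1 v' = n -> p2 v = p2 v').
{ intros s s' Hs Hs'. apply (ind_Sg (fun n =>
    forall v, v < p1 s -> forall v', v' < p1 s' -> incode v s -> incode v' s' ->
    p1 v = n -> p1 v' = n -> p2 v = p2 v')).
  - sg.
  - intros v _ v' _ Hv Hv' E E'.
    destruct (step s Hs v Hv) as [[_ H]|(u & _ & H & _)];
      [|rewrite E in H; now apply eq_sym, succ_neq_0 in H].
    destruct (step s' Hs' v' Hv') as [[_ H']|(u & _ & H' & _)];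
      [|rewrite E' in H'; now apply eq_sym, succ_neq_0 in H'].
    congruence.
  - intros n IH v _ v' _ Hv Hv' E E'.
    destruct (step s Hs v Hv) as [[H _]|(u & Hu & H & ->)];
      [rewrite E in H; now apply succ_neq_0 in H|].
    destruct (step s' Hs' v' Hv') as [[H' _]|(u' & Hu' & H' & ->)];
      [rewrite E' in H'; now apply succ_neq_0 in H'|].
    f_equal; apply (IH u (proj1 Hu) u' (proj1 Hu')); try assumption;
      apply succ_inj; congruence. }
assert (ext : forall s n y, good s -> incode (pair n y) s ->
  exists s', good s' /\ incode (pair (n + 1) (G y)) s').
{ intros s n y Hs Hy. set (v0 := pair (n + 1) (G y)).
  destruct (code_ex (fun v => incode v s \/ v = v0) (p1 s + v0 + 1)) as (s' & EN & Hs').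
  { xset. }
  assert (inc : forall v, incode v s -> incode v s').
  { intros v Hv; apply Hs'; split; [|now left].
    apply (lt_le_trans _ (p1 s)); [apply Hv|].
    apply le_iff; exists (v0 + 1); ring. }
  exists s'; split.
  - intros v _ Hv; apply Hs' in Hv as [_ [Hv| ->]].
    + destruct (step s Hs v Hv) as [H|(u & Hu & H)]; [now left|right].
      exists u; apply inc in Hu; split; [apply Hu|auto].
    + right; exists (pair n y). apply inc in Hy; split; [apply Hy|].
      unfold v0; rewrite !p1_pair, !p2_pair; auto.
  - apply Hs'; split; [|now right]. apply lt_iff; exists (p1 s); ring. }
destruct (Rec_choice (fun n y => exists s, good s /\ incode (pair n y) s)) as (F & HF & H).
- unfold Sg2. apply (Sg_ex (fun z s => good s /\ incode (pair (p1 z) (p2 z)) s)). sg.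
- apply ind_Sg.
  + apply (Sg_ex (fun n y => exists s, good s /\ incode (pair n y) s)).
    apply (Sg_ex (fun z s => good s /\ incode (pair (p1 z) (p2 z)) s)). sg.
  + exists a0. destruct (code_ex (fun v => v = pair 0 a0) (pair 0 a0 + 1)) as (s & _ & Hs).
    { xset. }
    exists s; split; [|apply Hs; split; [apply le_refl|reflexivity]].
    intros v _ Hv; apply Hs in Hv as [_ ->]. left; now rewrite p1_pair, p2_pair.
  + intros n (y & s & Hs & Hy). exists (G y). now apply (ext s n y).
- assert (eqF : forall n y s, good s -> incode (pair n y) s -> y = F n).
  { intros n y s Hs Hy. destruct (H n) as (s' & Hs' & Hy').
    assert (E := uniq s s' Hs Hs' n _ (proj1 Hy) _ (proj1 Hy') Hy Hy').
    rewrite !p1_pair, !p2_pair in E; auto. }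
  exists F; split; [assumption|]; split.
  + destruct (H 0) as (s & Hs & Hy).
    destruct (step s Hs _ Hy) as [[_ E]|(u & _ & E & _)].
    * now rewrite p2_pair in E.
    * rewrite p1_pair in E; now apply eq_sym, succ_neq_0 in E.
  + intros n. destruct (H n) as (s & Hs & Hy).
    destruct (ext s n (F n) Hs Hy) as (s' & Hs' & Hy').
    symmetry; now apply (eqF _ _ s').
Qed.

(** * Sigma1 separation *)

Section Tree.

Context (J : V -> V) (HJ : Rec J) (J_0 : J 0 = 1) (J_succ : forall n, J (n + 1) = J n + J n).

Lemma J_pos n : 0 < J n.
Proof.
revert n; apply ind_Sg; [sg|rewrite J_0; apply lt_0_1|].
intros n IH; rewrite J_succ. apply (lt_le_trans _ _ _ IH), le_add_r.
Qed.

Lemma J_gt n : n < J n.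
Proof.
revert n; apply ind_Sg; [sg|rewrite J_0; apply lt_0_1|].
intros n IH; rewrite J_succ. apply add_lt_le_mono; [assumption|].
apply one_le, J_pos.
Qed.

Lemma J_le_mono a b : a <= b -> J a <= J b.
Proof.
intros [c ->] %le_iff; revert c; apply ind_Sg; [sg|rewrite add_0_r; apply le_refl|].
intros c IH. rewrite add_assoc, J_succ. apply (le_trans _ _ _ IH), le_add_r.
Qed.

(** [J n] is 2^n, so level [n] of the heap numbering runs from [J n] up to, but excluding,
    [J (n + 1)]; monotonicity of [J] makes the levels disjoint. *)
Lemma level_unique a b d :
  J a <= d -> d < J (a + 1) -> J b <= d -> d < J (b + 1) -> a = b.
Proof.
assert (L : forall a b, d < J (a + 1) -> J b <= d -> ~ a < b).
{ intros a' b' H1 H2 H. apply (lt_irrefl d), (lt_le_trans _ (J (a' + 1))); [assumption|].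
  apply (le_trans _ (J b')); [|assumption]. now apply J_le_mono, succ_le_iff. }
intros H1 H2 H3 H4. destruct (lt_total a b) as [C|[C|C]]; [|assumption|];
  exfalso; [now apply (L a b)|now apply (L b a)].
Qed.

(** Ancestors in the heap numbering: appending [n] bits to [p] gives p * 2^n + r with r < 2^n. *)
Definition anc (p c : V) : Prop :=
  exists n, n <= c /\ exists r, r < J n /\ c = p * J n + r.

Lemma Xset2_anc : Xset2 anc.
Proof. unfold anc; xset. Qed.

Lemma anc_refl c : anc c c.
Proof.
exists 0; split; [apply le_0_l|]. exists 0; rewrite J_0; split; [apply lt_0_1|ring].
Qed.

Lemma child_gt c d : 0 < c -> child M c d -> c < d.
Proof.
intros Hc [-> | ->].
- rewrite <- (add_0_l c) at 1. now apply add_lt_mono_r.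
- apply le_add_r.
Qed.

Lemma anc_child p c d : 0 < c -> anc p c -> child M c d -> anc p d.
Proof.
intros Hc (n & Hn & r & Hr & E) Hd. exists (n + 1); split.
- apply (proj1 (succ_lt_mono _ _)), (le_lt_trans _ c); [assumption|]. now apply child_gt.
- rewrite J_succ. destruct Hd as [-> | ->].
  + exists (r + r); split; [now apply double_lt|]. rewrite E; ring.
  + exists (r + r + 1); split; [|rewrite E; ring].
    apply succ_le_iff in Hr. apply (add_le_mono _ _ _ _ Hr) in Hr.
    apply succ_le_iff. eapply le_trans; [|exact Hr].
    apply le_iff; exists 0; ring.
Qed.

Lemma anc_parent p c d : 0 < p -> anc p d -> child M c d -> p = d \/ anc p c.
Proof.
intros Hp (n & Hn & r & Hr & E) Hd.
destruct (zero_or_succ n) as [-> |[m ->]].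
- left. rewrite J_0 in *. rewrite <- (add_0_l 1) in Hr at 1.
  apply lt_succ in Hr as [Hr| ->]; [now apply nlt_0 in Hr|]. rewrite E; ring.
- right. rewrite J_succ in *.
  assert (H : exists r', r' < J m /\ c = p * J m + r').
  { destruct (even_or_odd r) as [h [-> | ->]]; exists h.
    - split; [now apply double_lt_inv|]. apply double_inj.
      destruct Hd as [Hd|Hd]; rewrite Hd in E.
      + rewrite E; ring.
      + exfalso. apply (even_not_odd (p * J m + h) c). rewrite E; ring.
    - split.
      { apply double_lt_inv. apply (lt_trans _ (h + h + 1)); [apply le_refl|assumption]. }
      apply double_inj.
      destruct Hd as [Hd|Hd]; rewrite Hd in E.
      + exfalso. apply (even_not_odd c (p * J m + h)). rewrite E; ring.
      + apply succ_inj. rewrite E; ring. }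
  destruct H as (r' & Hr' & Ec). exists m; split; [|exists r'; auto].
  apply lt_le, (lt_le_trans _ _ _ (J_gt m)). rewrite Ec.
  apply (le_trans _ (p * J m)); [|apply le_add_r].
  rewrite <- (mul_1_l (J m)) at 1. apply mul_le_mono; [|apply le_refl].
  now apply one_le.
Qed.

Context (Y0 Y1 : S).

(* The node [p] at level [k + 1] asserts [k] in the separating set if it is odd
   and not in it if it is even; [s] bounds the search for a refutation. *)
Definition bad (s p : V) : Prop :=
  exists k, k <= p /\ (J (k + 1) <= p /\ p < J (k + 1 + 1) /\
    ((exists h, h <= p /\ (p = h + h + 1 /\ exists w, w < s /\ mem (pair k w) Y0)) \/
     (exists h, h <= p /\ (p = h + h /\ exists w, w < s /\ mem (pair k w) Y1)))).

Lemma Xset2_bad : Xset2 bad.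
Proof. unfold bad; xset. Qed.

Lemma bad_mono s t p : s <= t -> bad s p -> bad t p.
Proof.
intros Hst (k & Hk & H1 & H2 & [(h & Hh & E & w & Hw & Hm)|(h & Hh & E & w & Hw & Hm)]);
  exists k; (split; [assumption|]); (split; [assumption|]); (split; [assumption|]);
  [left|right]; exists h; (split; [assumption|]); (split; [assumption|]);
  exists w; (split; [now apply (lt_le_trans _ s)|assumption]).
Qed.

(** The stage [s] is kept apart from the node: [node_ex] works at one fixed stage, while the tree
    takes each node's own number as its stage. *)
Definition node (s c : V) : Prop :=
  0 < c /\ forall p, p <= c -> 0 < p -> anc p c -> ~ bad s p.

Lemma Xset2_node : Xset2 node.
Proof. assert (H1 := Xset2_anc); assert (H2 := Xset2_bad). unfold node; xset. Qed.

Context (Hdisj : forall k v w, mem (pair k v) Y0 -> ~ mem (pair k w) Y1).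

(** Append a bit that is never refuted: 0 if [n] has a witness in [Y0], where disjointness excludes
    one in [Y1], and 1 otherwise. This case distinction is classical, but the statement proved by
    induction is Sigma1. *)
Lemma node_ex s n : exists c, node s c /\ J n <= c /\ c < J (n + 1).
Proof.
revert n; apply ind_Sg.
{ assert (H := Xset2_node).
  apply (Sg_ex (fun n c => node s c /\ J n <= c /\ c < J (n + 1))). sg. }
- exists 1. rewrite J_succ, J_0. split; [|split; [apply le_refl|]].
  + split; [apply lt_0_1|]. intros p Hp Hp0 _ (k & _ & H & _).
    apply (lt_irrefl (1 + 1)). apply (le_lt_trans _ p); [|assumption].
    apply (le_trans _ (J (k + 1))); [|assumption].
    rewrite J_succ. assert (L : 1 <= J k).
    { apply one_le, J_pos. }
    now apply add_le_mono.
  + apply le_refl.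
- intros n (c & [Hc Hn] & H1 & H2).
  assert (Hlev : forall d, child M c d -> J (n + 1) <= d /\ d < J (n + 1 + 1)).
  { intros d Hd. rewrite (J_succ (n + 1)), (J_succ n) in *. split.
    - apply (le_trans _ (c + c)); [now apply add_le_mono|].
      destruct Hd as [-> | ->]; [apply le_refl|apply le_add_r].
    - apply succ_le_iff in H2. apply (add_le_mono _ _ _ _ H2) in H2.
      apply succ_le_iff. eapply le_trans; [|exact H2]. apply le_iff.
      destruct Hd as [-> | ->]; [exists 1|exists 0]; ring. }
  assert (K : forall d, child M c d -> ~ bad s d ->
    exists c, node s c /\ J (n + 1) <= c /\ c < J (n + 1 + 1)).
  { intros d Hd Hb. exists d; split; [|now apply Hlev]. split.
    - apply (lt_trans _ c); [assumption|]. now apply child_gt.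
    - intros p _ Hp0 Hp. destruct (anc_parent p c d Hp0 Hp Hd) as [-> |Hpc]; [assumption|].
      apply Hn; try assumption. destruct Hpc as (m & _ & r & _ & ->).
      apply (le_trans _ (p * J m)); [|apply le_add_r].
      rewrite <- (mul_1_l p) at 1. rewrite mul_comm. apply mul_le_mono; [apply le_refl|].
      apply one_le, J_pos. }
  destruct (classic (exists w, mem (pair n w) Y0)) as [[v Hv]|HN].
  + apply (K (c + c)); [now left|]. intros (k & _ & L1 & L2 & H).
    destruct (Hlev (c + c)) as [L3 L4]; [now left|].
    assert (E : k + 1 = n + 1) by now apply (level_unique _ _ (c + c)).
    apply succ_inj in E as ->.
    destruct H as [(h & _ & E & _)|(h & _ & _ & w & _ & Hw)].
    * now apply even_not_odd in E.
    * now apply (Hdisj n v w).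
  + apply (K (c + c + 1)); [now right|]. intros (k & _ & L1 & L2 & H).
    destruct (Hlev (c + c + 1)) as [L3 L4]; [now right|].
    assert (E : k + 1 = n + 1) by now apply (level_unique _ _ (c + c + 1)).
    apply succ_inj in E as ->.
    destruct H as [(h & _ & _ & w & _ & Hw)|(h & _ & E & _)].
    * eauto.
    * now apply eq_sym, even_not_odd in E.
Qed.

Lemma separation_path :
  exists D, Xset D /\ forall k w, (mem (pair k w) Y0 -> ~ D k) /\ (mem (pair k w) Y1 -> D k).
Proof.
assert (Hnode := Xset2_node). assert (Hanc := Xset2_anc).
(* The stage [c] bounds the search, so the tree is a set of [X]; a parent has a smaller stage and
   its ancestors are ancestors of the child, so parents stay in the tree. *)
assert (HT : Xset (fun c => node c c)) by xset. destruct HT as [T HT].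
assert (Ttree : is_tree M S mem T).
{ split.
  - intros c Hc; apply HT in Hc; apply Hc.
  - intros p c Hc Hp Hpc; apply HT in Hc as [Hc H]. apply HT; split; [assumption|].
    assert (Lt := child_gt p c Hp Hpc).
    intros q Hq Hq0 Hqp Hb. apply (H q); try assumption.
    + apply (le_trans _ _ _ Hq), lt_le; assumption.
    + now apply (anc_child q p c).
    + apply (bad_mono p); [now apply lt_le|assumption]. }
assert (Tinf : infinite_set M S mem T).
(* Every node of level [m] is below [J (m + 1)], so surviving that stage implies surviving its
   own. *)
{ intros m. destruct (node_ex (J (m + 1)) m) as (c & [Hc Hn] & H1 & H2).
  exists c; split; [apply (lt_le_trans _ _ _ (J_gt m) H1)|].
  apply HT; split; [assumption|]. intros p Hp Hp0 Ha Hb. apply (Hn p Hp Hp0 Ha).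
  apply (bad_mono c); [now apply lt_le|assumption]. }
destruct (Hwkl T Ttree Tinf) as (P & PT & _ & P1 & Pchild).
assert (Ppos : forall c, mem c P -> 0 < c) by (intros c Hc; apply Ttree; auto).
assert (Plev : forall n, exists c, mem c P /\ J n <= c /\ c < J (n + 1)).
{ apply ind_Sg.
  - apply (Sg_ex (fun n c => mem c P /\ J n <= c /\ c < J (n + 1))). sg.
  - exists 1; rewrite J_succ, J_0; repeat split; [assumption|apply le_refl|].
    apply le_refl.
  - intros n (c & Hc & H1 & H2). destruct (Pchild c Hc) as (d & Hd & HdP & _).
    exists d; split; [assumption|]. rewrite (J_succ (n + 1)), (J_succ n) in *. split.
    + apply (le_trans _ (c + c)); [now apply add_le_mono|].
      destruct Hd as [-> | ->]; [apply le_refl|apply le_add_r].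
    + apply succ_le_iff in H2. apply (add_le_mono _ _ _ _ H2) in H2.
      apply succ_le_iff. eapply le_trans; [|exact H2]. apply le_iff.
      destruct Hd as [-> | ->]; [exists 1|exists 0]; ring. }
assert (Pdesc : forall p, mem p P -> forall m, exists c, mem c P /\ anc p c /\ m <= c).
{ intros p Hp. apply ind_Sg.
  - apply (Sg_ex (fun m c => mem c P /\ anc p c /\ m <= c)). sg.
  - exists p; repeat split; [assumption|apply anc_refl|apply le_0_l].
  - intros m (c & Hc & Ha & Hm). destruct (Pchild c Hc) as (d & Hd & HdP & _).
    exists d; repeat split; [assumption|apply (anc_child p c); auto|].
    apply (proj1 (succ_lt_mono _ _)), (le_lt_trans _ c); [assumption|].
    apply child_gt; auto. }
(* A refutation of [p] at stage [s] is seen by every descendant numbered at least [s]. The path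
   contains one, which could then not be in the tree. *)
assert (Pgood : forall p s, mem p P -> ~ bad s p).
{ intros p s Hp Hb. destruct (Pdesc p Hp (s + p)) as (c & Hc & Ha & Hs).
  apply PT, HT in Hc as [_ H]. apply (H p); auto.
  - apply (le_trans _ (s + p)); [apply le_add_l|assumption].
  - apply (bad_mono s); [|assumption]. apply (le_trans _ (s + p)); [apply le_add_r|assumption]. }
(* [pk k] is a node of the path at level k + 1; its last bit decides the membership of [k]. *)
destruct (Rec_choice (fun k p => mem p P /\ J (k + 1) <= p /\ p < J (k + 1 + 1)))
  as (pk & Hpk & Hp); [sg|intros k; apply Plev|].
assert (bound : forall k, k <= pk k).
{ intros k; destruct (Hp k) as (_ & H & _). apply lt_le.
  apply (lt_le_trans _ (J (k + 1))); [|assumption].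
  apply (lt_trans _ (k + 1)); [apply le_refl|apply J_gt]. }
exists (fun k => exists h, h <= pk k /\ pk k = h + h + 1); split; [xset|].
assert (half : forall h, h <= h + h) by (intros; apply le_add_r).
intros k w; destruct (Hp k) as (HP & L1 & L2). split.
- intros Hm (h & Hh & E). apply (Pgood (pk k) (w + 1) HP).
  exists k; repeat split; auto. left; exists h; repeat split; auto.
  exists w; split; [apply le_refl|assumption].
- intros Hm. destruct (even_or_odd (pk k)) as [h [E|E]].
  + exfalso; apply (Pgood (pk k) (w + 1) HP).
    exists k; repeat split; auto. right; exists h; repeat split; auto.
    * rewrite E; auto.
    * exists w; split; [apply le_refl|assumption].
  + exists h; split; [|assumption]. rewrite E.
    apply (le_trans _ (h + h)); [auto|apply le_add_r].
Qed.

End Tree.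

Lemma Sigma1_separation (P0 P1 : V -> Prop) :
  Sg P0 -> Sg P1 -> (forall n, P0 n -> ~ P1 n) ->
  exists D, Xset D /\ forall n, (P0 n -> ~ D n) /\ (P1 n -> D n).
Proof.
intros [Y0 H0] [Y1 H1] Hd.
destruct (primitive_recursion (fun x => x + x) 1) as (J & HJ & J0 & JS); [rec|].
destruct (separation_path J HJ J0 JS Y0 Y1) as (D & HD & H).
- intros k v w Hv Hw. apply (Hd k); [apply H0|apply H1]; eauto.
- exists D; split; [assumption|]. intros n; split.
  + intros Hn; apply H0 in Hn as [w Hw]; now apply (H n w).
  + intros Hn; apply H1 in Hn as [w Hw]; now apply (H n w).
Qed.

(** * Bounded choice and pigeonhole *)

(* Let [bb i x s] say that some [y < s] refutes the value [x] at [i].  The set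
   [D] of the proof decides, for each [x < h i], whether to skip [x]: it contains
   [pair i x] if [x] is refuted strictly before all of the later values are, and
   omits it if all of the later values are refuted strictly before [x].  The
   first value that is not skipped is then never refuted. *)
Lemma bounded_choice (A : V -> Prop) (h : V -> V) (R : V -> V -> V -> Prop) :
  Xset A -> Rec h -> Xset3 R ->
  (forall i, A i -> exists x, x < h i /\ forall y, ~ R i x y) ->
  exists g, Rec g /\ forall i, A i -> g i < h i /\ forall y, ~ R i (g i) y.
Proof.
intros HA Hh HR H.
set (bb := fun i x s => exists y, y < s /\ R i x y).
assert (Hbb : Xset3 bb) by (unfold bb; xset).
assert (bbmono : forall i x s t, s <= t -> bb i x s -> bb i x t).
{ intros i x s t Hst (y & Hy & Hr); exists y; split; [|assumption].
  now apply (lt_le_trans _ s). }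
set (later := fun i x s => forall x', x' < h i -> x < x' -> bb i x' s).
assert (Hlater : Xset3 later) by (unfold later; xset).
assert (latermono : forall i x s t, s <= t -> later i x s -> later i x t).
{ intros i x s t Hst L x' H1 H2; apply (bbmono _ _ s); auto. }
destruct (Sigma1_separation
  (fun z => exists s, later (p1 z) (p2 z) s /\ ~ bb (p1 z) (p2 z) s)
  (fun z => exists s, bb (p1 z) (p2 z) s /\ ~ later (p1 z) (p2 z) s)) as (D & HD & Hsep).
- apply (Sg_ex (fun z s => later (p1 z) (p2 z) s /\ ~ bb (p1 z) (p2 z) s)). sg.
- apply (Sg_ex (fun z s => bb (p1 z) (p2 z) s /\ ~ later (p1 z) (p2 z) s)). sg.
- intros z (s & H1 & H2) (t & H3 & H4). destruct (le_total s t) as [L|L].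
  + apply H4. now apply (latermono _ _ s).
  + apply H2. apply (bbmono _ _ t); [now apply lt_le|assumption].
- assert (Hsep' : forall i x, (forall s, later i x s -> ~ bb i x s -> ~ D (pair i x)) /\
    (forall s, bb i x s -> ~ later i x s -> D (pair i x))).
  { intros i x; destruct (Hsep (pair i x)) as [H1 H2]; rewrite p1_pair, p2_pair in *.
    split; eauto. }
  destruct (Rec_least (fun i x => h i <= x \/ ~ D (pair i x))) as (g & Hg & Hgl).
  + xset.
  + intros i; exists (h i); left; apply le_refl.
  + exists g; split; [assumption|]. intros i Hi. apply NNPP; intros N.
    destruct (Hgl i) as [G1 G2].
    (* If [g i] is below [h i], it is not in [D], and by assumption it is refuted at some stage;
       separation then forces all later values to be refuted by that stage. *)
    assert (Hs : exists s, forall x, x < h i -> g i <= x -> bb i x s).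
    { destruct (le_total (h i) (g i)) as [L|L].
      - exists 0. intros x Hx Hgx. exfalso. apply (lt_irrefl x).
        apply (lt_le_trans _ (h i)); [assumption|]. now apply (le_trans _ (g i)).
      - assert (ND : ~ D (pair i (g i))).
        { destruct G1 as [G1|G1]; [|assumption]. now apply nle_lt in L. }
        assert (Hy : exists y, R i (g i) y).
        { apply NNPP; intros N'; apply N; split; [assumption|]. intros y Hy; eauto. }
        destruct Hy as [y Hy].
        assert (Hb : bb i (g i) (y + 1)) by (exists y; split; [apply le_refl|assumption]).
        exists (y + 1). intros x Hx Hgx. apply lt_succ in Hgx as [Hgx| <-]; [|assumption].
        apply NNPP; intros Nb; apply ND, (proj2 (Hsep' i (g i)) (y + 1)); [assumption|].
        intros L'; apply Nb, L'; assumption. }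
    destruct Hs as [s Hs].
    (* Downward induction from [g i] with [s] fixed: every smaller value was skipped, and separation
       forbids skipping a value that is unrefuted at [s] while all later ones are refuted by [s]. *)
    assert (Hall : forall n, forall x, x < h i -> g i <= x + n -> bb i x s).
    { apply (ind_Sg (fun n => forall x, x < h i -> g i <= x + n -> bb i x s)); [sg| |].
      - intros x Hx; rewrite add_0_r; auto.
      - intros n IH x Hx Hgx. destruct (le_total (g i) x) as [L|L]; [auto|].
        assert (Dx : D (pair i x)).
        { apply NNPP; intros Nd; apply (G2 x L); now right. }
        assert (Lx : later i x s).
        { intros x' Hx' Hlt. apply IH; [assumption|].
          apply (le_trans _ _ _ Hgx). replace (x + (n + 1)) with (x + 1 + n) by ring.
          apply add_le_mono; [now apply succ_le_iff|apply le_refl]. }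
        apply NNPP; intros Nb. now apply (proj1 (Hsep' i x) s). }
    destruct (H i Hi) as (x & Hx & Nx). destruct (Hall (g i) x Hx) as (y & _ & Hy).
    * apply le_add_l.
    * now apply (Nx y).
Qed.

Definition unbounded (A : V -> Prop) : Prop := forall m, exists i, m < i /\ A i.

(* The subset consists of the record values of an enumeration of [A]. *)
Lemma unbounded_Sigma1_subset (A : V -> Prop) :
  Sg A -> unbounded A -> exists B, Xset B /\ unbounded B /\ forall i, B i -> A i.
Proof.
intros [Y HY] HA.
destruct (Rec_least (fun m z => (mem z Y /\ z = pair (p1 z) (p2 z)) /\ m <= p1 z))
  as (F & HF & H).
- xset.
- intros m. destruct (HA m) as (i & Hi & Ai). apply HY in Ai as [w Hw].
  exists (pair i w). rewrite p1_pair, p2_pair. repeat split; auto. now apply lt_le.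
- exists (fun i => p1 (F i) = i). split; [xset|]. split.
  + intros m. destruct (H (m + 1)) as [[H1 H2] H3].
    exists (p1 (F (m + 1))). split; [now apply succ_le_iff|].
    (* The two searches have the same result: each result is admissible in the other search. *)
    f_equal. destruct (H (p1 (F (m + 1)))) as [[H4 H5] H6].
    apply le_antisym; apply nlt_le; intros L.
    * apply (H6 _ L). split; [assumption|apply le_refl].
    * apply (H3 _ L). split; [assumption|]. now apply (le_trans _ _ _ H2).
  + intros i Ei. destruct (H i) as [[[H1 H2] _] _]. apply HY. exists (p2 (F i)).
    rewrite <- Ei at 1. now rewrite <- H2.
Qed.

(** Collection is applied to a Pi1 matrix, stating that no pair with value [c] occurs beyond [b]. If
    every c < m had such a bound, a common bound, together with one beyond which values stay below
    [m], would bound [A]. *)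
Lemma pigeonhole (A : V -> Prop) (F : V -> V) (m : V) :
  Xset A -> Rec F -> unbounded A ->
  unbounded (fun i => A i /\ m <= F i) \/
  exists c, c < m /\ unbounded (fun i => A i /\ F i = c).
Proof.
intros HA HF HU. apply NNPP; intros N.
apply not_or_and in N as [N1 N2].
apply not_all_ex_not in N1 as [b0 N1].
assert (HY : Xset (fun z => A (p1 z) /\ F (p1 z) = p2 z)) by xset.
destruct HY as [Y HY].
assert (HY' : forall i c, mem (pair i c) Y <-> A i /\ F i = c).
{ intros i c; now rewrite HY, p1_pair, p2_pair. }
assert (HD : defD0 3 (fun e => e 1%nat < e O -> ~ mem (pair (e O) (e 2%nat)) Y)) by d0.
destruct HD as [f [Hf Ef]].
assert (E : forall b c, (forall i, b < i -> ~ mem (pair i c) Y) <->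
  sat M S mem (fall f) (scons b (scons c e0)) se0).
{ intros b c; split; intros H i.
  - apply (Ef (scons i (scons b (scons c e0)))). exact (H i).
  - exact (proj2 (Ef (scons i (scons b (scons c e0)))) (H i)). }
destruct (Hcol (fall f)) with (e := e0) (se := se0) (a := m) as [b1 Hb1].
- apply SigPi, PiAll, PiSig, Sig0, Hf.
- intros c Hc. apply NNPP; intros N. apply N2; exists c; split; [assumption|].
  intros b. apply NNPP; intros N3. apply N; exists b. apply E.
  intros i Hi Hm. apply N3; exists i. now apply HY' in Hm.
- destruct (HU (b0 + b1)) as (i & Hi & Ai).
  destruct (le_total m (F i)) as [L|L].
  + apply N1; exists i; split; [|auto]. apply (le_lt_trans _ (b0 + b1)); [|assumption].
    apply le_add_r.
  + destruct (Hb1 (F i) L) as (b & Hb & Hs). pose proof (proj2 (E b (F i)) Hs) as Hs'.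
    apply (Hs' i); [|now apply HY'].
    apply (lt_trans _ b1); [assumption|].
    apply (le_lt_trans _ (b0 + b1)); [apply le_add_l|assumption].
Qed.

(** * Generic sequences *)

(** Requirements are indexed by sets, not functions, so that [se0] lists them all; an index that is
    not a graph gives a vacuous requirement. *)
Definition graph (Y : S) (F : V -> V) : Prop := forall x y, mem (pair x y) Y <-> y = F x.

Definition decides_bound (Y : S) (m : V) (B : V -> Prop) : Prop :=
  forall F, graph Y F ->
    (forall i, B i -> m <= F i) \/ exists c, c < m /\ forall i, B i -> F i = c.

(** The two fates of a collection instance in the ultrapower: [b] will represent a bound on
    witnesses, [g] an element below the bound [h] that has no witness. *)
Definition decides_choice (Y Z : S) (B : V -> Prop) : Prop :=
  forall h, graph Y h ->
    (exists b, Rec b /\ forall i, B i -> forall x, x < h i ->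
       exists z, z < b i /\ mem (pair (pair i x) z) Z) \/
    (exists g, Rec g /\ forall i, B i -> g i < h i /\ forall z, ~ mem (pair (pair i (g i)) z) Z).

Lemma graph_ext Y F G : graph Y F -> graph Y G -> forall x, F x = G x.
Proof. intros HF HG x; apply HG, HF; reflexivity. Qed.

Lemma decides_bound_dense Y m A :
  Xset A -> unbounded A ->
  exists B, (Xset B /\ unbounded B) /\ (forall i, B i -> A i) /\ decides_bound Y m B.
Proof.
intros HA UA. destruct (classic (exists F, graph Y F)) as [[F HF]|N].
- assert (RF : Rec F) by now exists Y.
  destruct (pigeonhole A F m HA RF UA) as [U|(c & Hc & U)].
  + exists (fun i => A i /\ m <= F i). split; [split; [xset|assumption]|].
    split; [tauto|]. intros G HG; left. intros i [_ Hi]. now rewrite (graph_ext Y G F).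
  + exists (fun i => A i /\ F i = c). split; [split; [xset|assumption]|].
    split; [tauto|]. intros G HG; right. exists c; split; [assumption|].
    intros i [_ Hi]. now rewrite (graph_ext Y G F).
- exists A; repeat split; auto. intros F HF; exfalso; eauto.
Qed.

Lemma decides_choice_dense Y Z A :
  Xset A -> unbounded A ->
  exists B, (Xset B /\ unbounded B) /\ (forall i, B i -> A i) /\ decides_choice Y Z B.
Proof.
intros HA UA. destruct (classic (exists h, graph Y h)) as [[h Hh]|N];
  [|exists A; repeat split; auto; intros F HF; exfalso; eauto].
assert (Rh : Rec h) by now exists Y.
set (C := fun i => A i /\ forall x, x < h i -> exists z, mem (pair (pair i x) z) Z).
destruct (classic (unbounded C)) as [UC|UC].
- destruct (unbounded_Sigma1_subset C) as (B & HB & UB & BC); [unfold C; sg|assumption|].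
  exists B; split; [auto|]. split; [intros i Hi; now apply BC|].
  intros h' Hh'. left.
  destruct (Rec_choice (fun i b => B i -> forall x, x < h i ->
    exists z, z < b /\ mem (pair (pair i x) z) Z)) as (b & Rb & Hb); [sg| |].
  + intros i. destruct (classic (B i)) as [Bi|Bi]; [|now exists 0].
    destruct (collection_mem Z i (h i)) as [c Hc]; [apply BC, Bi|].
    exists c; auto.
  + exists b; split; [assumption|]. intros i Bi x.
    rewrite (graph_ext Y h' h Hh' Hh). now apply Hb.
- apply not_all_ex_not in UC as [m Hm].
  assert (HB : Xset (fun i => A i /\ m < i)) by xset.
  exists (fun i => A i /\ m < i). split; [split; [assumption|]|split; [tauto|]].
  { intros n. destruct (UA (n + m)) as (i & Hi & Ai). exists i; repeat split; [|assumption|].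
    - apply (le_lt_trans _ (n + m)); [apply le_add_r|assumption].
    - apply (le_lt_trans _ (n + m)); [apply le_add_l|assumption]. }
  intros h' Hh'. right.
  destruct (bounded_choice (fun i => A i /\ m < i) h (fun i x z => mem (pair (pair i x) z) Z))
    as (g & Rg & Hg); [assumption|assumption|xset| |].
  + intros i [Ai Hi]. apply NNPP; intros N. apply Hm; exists i; split; [assumption|].
    split; [assumption|]. intros x Hx; apply NNPP; intros N'. apply N; exists x; eauto.
  + exists g; split; [assumption|]. intros i Bi. rewrite (graph_ext Y h' h Hh' Hh).
    now apply Hg.
Qed.

Definition requirement (n : nat) (B : V -> Prop) : Prop :=
  decides_bound (se0 (fst (of_nat n))) (e0 (snd (of_nat n))) B /\
  decides_choice (se0 (fst (of_nat n))) (se0 (snd (of_nat n))) B.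

Lemma generic_sequence :
  exists U : nat -> V -> Prop, (forall n, Xset (U n)) /\ (forall n, unbounded (U n)) /\
    (forall n i, U (Datatypes.S n) i -> U n i) /\ forall n, requirement n (U (Datatypes.S n)).
Proof.
set (cond := {A : V -> Prop | Xset A /\ unbounded A}).
assert (D : forall n (A : cond), exists B : cond,
  (forall i, proj1_sig B i -> proj1_sig A i) /\ requirement n (proj1_sig B)).
{ intros n (A & HA & UA); simpl.
  destruct (decides_bound_dense (se0 (fst (of_nat n))) (e0 (snd (of_nat n))) A HA UA)
    as (B & [HB UB] & BA & DB).
  destruct (decides_choice_dense (se0 (fst (of_nat n))) (se0 (snd (of_nat n))) B HB UB)
    as (C & HC & CB & DC).
  exists (exist _ C HC); simpl; split; [auto|]. split; [|assumption].
  (* The decision already made on [B] is inherited by its subset [C]. *)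
  intros F HF. destruct (DB F HF) as [H|(c & Hc & H)]; [left; auto|right].
  exists c; split; [assumption|]; auto. }
assert (T : cond).
{ exists (fun _ => True); split; [apply Xset_const|]. intros m; exists (m + 1).
  split; [apply le_refl|exact I]. }
set (next := fun n A => proj1_sig (constructive_indefinite_description _ (D n A))).
set (U := fix U n := match n with O => T | Datatypes.S n => next n (U n) end).
exists (fun n => proj1_sig (U n)). repeat split.
- intros n; apply (proj2_sig (U n)).
- intros n; apply (proj2_sig (U n)).
- intros n i; simpl; unfold next; destruct constructive_indefinite_description as [B HB].
  apply HB.
- simpl; unfold next; destruct constructive_indefinite_description as [B HB]. apply HB.
- simpl; unfold next; destruct constructive_indefinite_description as [B HB]. apply HB.
Qed.

(** * The ultrapower *)

Lemma Rec_teval (e : nat -> V -> V) (t : term) :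
  (forall n, Rec (e n)) -> Rec (fun i => teval M (fun n => e n i) t).
Proof.
intros He; induction t as [n| | |t IHt u IHu|t IHt u IHu]; simpl.
- apply He.
- apply Rec_const.
- apply Rec_const.
- rec.
- rec.
Qed.

Lemma Rec_scons (F : V -> V) (e : nat -> V -> V) :
  Rec F -> (forall n, Rec (e n)) -> forall n, Rec (scons F e n).
Proof. intros HF He [|n]; simpl; auto. Qed.

Lemma scons_app (F : V -> V) (e : nat -> V -> V) (i : V) :
  (fun n => scons F e n i) = scons (F i) (fun n => e n i).
Proof. apply functional_extensionality; intros [|n]; reflexivity. Qed.

(* The environment of the paired argument [j]: its second component is the
   value of the bound variable, the first one is the old argument. *)
Definition bind (e : nat -> V -> V) : nat -> V -> V := scons p2 (fun n j => e n (p1 j)).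

Lemma Rec_bind (e : nat -> V -> V) : (forall n, Rec (e n)) -> forall n, Rec (bind e n).
Proof.
intros He; apply Rec_scons; [apply Rec_p2|]. intros n. specialize (He n).
apply (Rec_comp (e n)); [assumption|apply Rec_p1].
Qed.

Lemma bind_app (e : nat -> V -> V) (j : V) :
  (fun n => bind e n j) = scons (p2 j) (fun n => e n (p1 j)).
Proof. exact (scons_app p2 (fun n j => e n (p1 j)) j). Qed.

(** A bounded variable is moved into the argument by [bind], after which closure under bounded
    quantifiers applies. Hence the generic sequence decides truth sets of Delta0 formulas. *)
Lemma Xset_sat phi : isD0 phi -> forall (e : nat -> V -> V) se, (forall n, Rec (e n)) ->
  Xset (fun i => sat M S mem phi (fun n => e n i) se).
Proof.
induction 1 as [t u|t u|t j|p _ IHp|p q _ IHp _ IHq|p q _ IHp _ IHq|p q _ IHp _ IHq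
  |t p _ IHp|t p _ IHp]; intros e se He; simpl.
- assert (Ht := Rec_teval e t He); assert (Hu := Rec_teval e u He). now apply Xset_eq.
- assert (Ht := Rec_teval e t He); assert (Hu := Rec_teval e u He). now apply Xset_lt.
- assert (Ht := Rec_teval e t He).
  now apply (Xset_comp (fun n => mem n (se j))); [apply Xset_mem|].
- apply (Xset_not (fun i => sat M S mem p (fun n => e n i) se)); auto.
- apply (Xset_and (fun i => sat M S mem p (fun n => e n i) se)); auto.
- apply (Xset_or (fun i => sat M S mem p (fun n => e n i) se)); auto.
- apply (Xset_imp (fun i => sat M S mem p (fun n => e n i) se)); auto.
- apply (Xset_ball (fun i => teval M (fun n => e n i) t)
    (fun i a => sat M S mem p (scons a (fun n => e n i)) se)).
  + now apply Rec_teval.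
  + apply (Xset_ext _ _ (IHp (bind e) se (Rec_bind e He))).
    intros j; now rewrite bind_app.
- apply (Xset_bex (fun i => teval M (fun n => e n i) t)
    (fun i a => sat M S mem p (scons a (fun n => e n i)) se)).
  + now apply Rec_teval.
  + apply (Xset_ext _ _ (IHp (bind e) se (Rec_bind e He))).
    intros j; now rewrite bind_app.
Qed.

Lemma isSigma1_ind (P : form -> Prop) :
  (forall p, isD0 p -> P p) -> (forall p, isSigma 1 p -> P p -> P (fex p)) ->
  forall p, isSigma 1 p -> P p.
Proof.
intros H0 H1 p Hp. remember 1%nat as k eqn:Ek.
induction Hp as [p Hp|k p Hp|k p Hp IH]; [discriminate| |].
- injection Ek as ->. inversion Hp; subst; auto.
- injection Ek as ->. auto.
Qed.

Lemma isPi1_ind (P : form -> Prop) :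
  (forall p, isD0 p -> P p) -> (forall p, isPi 1 p -> P p -> P (fall p)) ->
  forall p, isPi 1 p -> P p.
Proof.
intros H0 H1 p Hp. remember 1%nat as k eqn:Ek.
induction Hp as [p Hp|k p Hp|k p Hp IH]; [discriminate| |].
- injection Ek as ->. inversion Hp; subst; auto.
- injection Ek as ->. auto.
Qed.

Lemma isSigma2_ind (P : form -> Prop) :
  (forall p, isPi 1 p -> P p) -> (forall p, isSigma 2 p -> P p -> P (fex p)) ->
  forall p, isSigma 2 p -> P p.
Proof.
intros H0 H1 p Hp. remember 2%nat as k eqn:Ek.
induction Hp as [p Hp|k p Hp|k p Hp IH]; [discriminate| |].
- injection Ek as ->. auto.
- injection Ek as ->. auto.
Qed.

Lemma Sg_sat phi : isSigma 1 phi -> forall (e : nat -> V -> V) se, (forall n, Rec (e n)) ->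
  Sg (fun i => sat M S mem phi (fun n => e n i) se).
Proof.
revert phi; refine (isSigma1_ind _ _ _); [intros p Hp|intros p _ IHp]; intros e se He.
- now apply Xset_Sg, Xset_sat.
- simpl. apply (Sg_ex (fun i a => sat M S mem p (scons a (fun n => e n i)) se)).
  apply (Sg_ext _ _ (IHp (bind e) se (Rec_bind e He))).
  intros j; now rewrite bind_app.
Qed.

Lemma Sg_not_sat phi : isPi 1 phi -> forall (e : nat -> V -> V) se, (forall n, Rec (e n)) ->
  Sg (fun i => ~ sat M S mem phi (fun n => e n i) se).
Proof.
revert phi; refine (isPi1_ind _ _ _); [intros p Hp|intros p _ IHp]; intros e se He.
- now apply Xset_Sg, Xset_not, Xset_sat.
- apply (Sg_ext (fun i => exists a, ~ sat M S mem p (scons a (fun n => e n i)) se)).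
  + apply (Sg_ex (fun i a => ~ sat M S mem p (scons a (fun n => e n i)) se)).
    apply (Sg_ext _ _ (IHp (bind e) se (Rec_bind e He))).
    intros j; now rewrite bind_app.
  + intros i; simpl; split; [intros [a Ha] H; now apply Ha|apply not_all_ex_not].
Qed.

Section Ultrapower.

Context (U : nat -> V -> Prop) (HU : forall n, Xset (U n)) (Uunb : forall n, unbounded (U n))
  (Udec : forall n i, U (Datatypes.S n) i -> U n i)
  (Ureq : forall n, requirement n (U (Datatypes.S n))).

(** The filter generated by the sequence, which acts as an ultrafilter on the sets of [X]. *)
Definition large (P : V -> Prop) : Prop := exists n, forall i, U n i -> P i.

Lemma U_anti n m i : (n <= m)%nat -> U m i -> U n i.
Proof. induction 1; auto. Qed.

Lemma large_mono (P Q : V -> Prop) : large P -> (forall i, P i -> Q i) -> large Q.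
Proof. intros [n Hn] H; exists n; auto. Qed.

Lemma large_all (P : V -> Prop) : (forall i, P i) -> large P.
Proof. exists O; auto. Qed.

Lemma large_and (P Q : V -> Prop) : large P -> large Q -> large (fun i => P i /\ Q i).
Proof.
intros [n Hn] [m Hm]; exists (Nat.max n m); intros i Hi; split.
- apply Hn, (U_anti _ (Nat.max n m)); [lia|assumption].
- apply Hm, (U_anti _ (Nat.max n m)); [lia|assumption].
Qed.

Lemma large_mono2 (P Q R : V -> Prop) :
  large P -> large Q -> (forall i, P i -> Q i -> R i) -> large R.
Proof.
intros HP HQ H; apply (large_mono _ _ (large_and _ _ HP HQ)). intros i [? ?]; auto.
Qed.

Lemma large_ex (P : V -> Prop) (m : V) : large P -> exists i, m < i /\ P i.
Proof. intros [n Hn]. destruct (Uunb n m) as (i & Hi & Ui); eauto. Qed.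

Lemma large_const (P : Prop) : large (fun _ => P) -> P.
Proof. intros H; destruct (large_ex _ 0 H) as (_ & _ & HP); exact HP. Qed.

Lemma large_requirement (Y : S) (k : nat) :
  exists n, decides_bound Y (e0 k) (U n) /\ decides_choice Y (se0 k) (U n).
Proof.
destruct (Hse0 Y) as [j <-]. exists (Datatypes.S (to_nat (j, k))).
destruct (Ureq (to_nat (j, k))) as [H1 H2]. rewrite cancel_of_to in H1, H2. auto.
Qed.

Lemma large_bound F m : Rec F ->
  large (fun i => m <= F i) \/ exists c, c < m /\ large (fun i => F i = c).
Proof.
intros [Y HY]. destruct (He0 m) as [k <-].
destruct (large_requirement Y k) as (n & H & _).
destruct (H F HY) as [H'|(c & Hc & H')]; [left; now exists n|].
right; exists c; split; [assumption|now exists n].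
Qed.

Lemma large_bounded_choice h (Z : S) : Rec h ->
  (exists b, Rec b /\ large (fun i => forall x, x < h i ->
     exists z, z < b i /\ mem (pair (pair i x) z) Z)) \/
  (exists g, Rec g /\ large (fun i => g i < h i /\ forall z, ~ mem (pair (pair i (g i)) z) Z)).
Proof.
intros [Y HY]. destruct (Hse0 Z) as [k <-].
destruct (large_requirement Y k) as (n & _ & H).
destruct (H h HY) as [(b & Rb & H')|(g & Rg & H')]; [left; exists b|right; exists g];
  (split; [assumption|now exists n]).
Qed.

(** The choice requirement with bound 1 and a relation that ignores both the value and the
    witness. *)
Lemma large_dec P : Xset P -> large P \/ large (fun i => ~ P i).
Proof.
intros HP. assert (HZ : Xset (fun t => P (p1 (p1 t)))) by xset. destruct HZ as [Z HZ].
assert (HZ' : forall i x z, mem (pair (pair i x) z) Z <-> P i).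
{ intros i x z. now rewrite HZ, !p1_pair. }
destruct (large_bounded_choice (fun _ => 1) Z) as [(b & _ & H)|(g & _ & H)]; [rec| |].
- left. apply (large_mono _ _ H). intros i Hi.
  destruct (Hi 0 lt_0_1) as (z & _ & Hz). now apply HZ' in Hz.
- right. apply (large_mono _ _ H). intros i [_ Hi] Pi. apply (Hi 0). now apply HZ'.
Qed.

Lemma large_skolem (R : V -> V -> Prop) : Sg2 R -> large (fun i => exists y, R i y) ->
  exists g, Rec g /\ large (fun i => R i (g i)).
Proof.
intros HR [n Hn]. set (A := U n) in *. assert (HA : Xset A) by apply HU.
(* Allowing every value outside [A] makes the relation total; it remains Sigma1 because [A] is in
   [X]. *)
destruct (Rec_choice (fun i y => ~ A i \/ R i y)) as (g & Rg & Hg).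
- unfold Sg2 in *. sg.
- intros i. destruct (classic (A i)) as [Ai|Ai]; [|exists 0; now left].
  destruct (Hn i Ai) as [y Hy]; eauto.
- exists g; split; [assumption|]. exists n; intros i Ui. destruct (Hg i); tauto.
Qed.

(** [sat] reads [feq] as Rocq equality, so functions that agree on a large set have to become equal.
    The quotient consists of the functions that are their own canonical representatives. *)
Lemma quotient_ex : exists (Q : Type) (repr : Q -> V -> V),
  (forall q, Rec (repr q)) /\
  (forall F, Rec F -> exists q, large (fun i => repr q i = F i)) /\
  (forall a b, large (fun i => repr a i = repr b i) -> a = b).
Proof.
set (canon := fun F : V -> V => epsilon (inhabits F)
  (fun G => Rec G /\ large (fun i => G i = F i))).
assert (Hc : forall F, Rec F -> Rec (canon F) /\ large (fun i => canon F i = F i)).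
{ intros F HF. apply epsilon_spec. exists F; split; [assumption|now apply large_all]. }
assert (Heq : forall F G, Rec G -> large (fun i => F i = G i) -> canon F = canon G).
{ intros F G HG H. unfold canon.
  replace (fun G0 => Rec G0 /\ large (fun i => G0 i = F i))
    with (fun G0 => Rec G0 /\ large (fun i => G0 i = G i)).
  - apply epsilon_inh_irrelevance. exists G; split; [assumption|now apply large_all].
  - apply functional_extensionality; intros K. apply propositional_extensionality.
    split; intros [HK L]; (split; [assumption|]); apply (large_mono2 _ _ _ H L);
      intros i; congruence. }
exists {F : V -> V | Rec F /\ canon F = F}, (fun q => proj1_sig q). repeat split.
- intros q; apply (proj2_sig q).
- intros F HF. destruct (Hc F HF) as [H1 H2].
  exists (exist _ (canon F) (conj H1 (Heq _ _ HF H2))). exact H2.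
- intros [F [RF EF]] [G [RG EG]]; simpl; intros H. apply Heq in H; [|assumption].
  rewrite EF, EG in H. subst G. f_equal. apply proof_irrelevance.
Qed.

Context (Q : Type) (repr : Q -> V -> V) (Rec_repr : forall q, Rec (repr q))
  (mk : (V -> V) -> Q) (repr_mk : forall F, Rec F -> large (fun i => repr (mk F) i = F i))
  (repr_inj : forall a b, large (fun i => repr a i = repr b i) -> a = b).

Definition ultra : arith := {|
  car := Q;
  zero := mk (fun _ => 0);
  one := mk (fun _ => 1);
  add := fun a b => mk (fun i => repr a i + repr b i);
  mul := fun a b => mk (fun i => repr a i * repr b i);
  lt := fun a b => large (fun i => repr a i < repr b i) |}.

Definition umem (a : Q) (Y : S) : Prop := large (fun i => mem (repr a i) Y).

Definition emb (m : V) : Q := mk (fun _ => m).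

(** Agreement is asked for each variable separately, as infinitely many large sets need not have a
    large intersection; the induction in [teval_ultra] meets only finitely many. *)
Definition represents (e : nat -> V -> V) (eq : nat -> Q) : Prop :=
  forall n, Rec (e n) /\ large (fun i => repr (eq n) i = e n i).

Lemma represents_scons F q e eq :
  Rec F -> large (fun i => repr q i = F i) -> represents e eq ->
  represents (scons F e) (scons q eq).
Proof. intros HF Hq He [|n]; simpl; auto. Qed.

Lemma represents_Rec e eq : represents e eq -> forall n, Rec (e n).
Proof. intros He n; apply He. Qed.

Lemma teval_ultra e eq t : represents e eq ->
  large (fun i => repr (teval ultra eq t) i = teval M (fun n => e n i) t).
Proof.
intros He; induction t as [n| | |t IHt u IHu|t IHt u IHu]; simpl.
- apply He.
- apply repr_mk, Rec_const.
- apply repr_mk, Rec_const.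
- assert (Ht := Rec_repr (teval ultra eq t)); assert (Hu := Rec_repr (teval ultra eq u)).
  apply (large_mono2 _ _ _ (repr_mk _ (Rec_add _ _ Ht Hu)) (large_and _ _ IHt IHu)).
  intros i E [E1 E2]; congruence.
- assert (Ht := Rec_repr (teval ultra eq t)); assert (Hu := Rec_repr (teval ultra eq u)).
  apply (large_mono2 _ _ _ (repr_mk _ (Rec_mul _ _ Ht Hu)) (large_and _ _ IHt IHu)).
  intros i E [E1 E2]; congruence.
Qed.

(** * Los' theorem for Sigma1 formulas *)

Definition los (phi : form) : Prop := forall e eq se, represents e eq ->
  (sat ultra S umem phi eq se <-> large (fun i => sat M S mem phi (fun n => e n i) se)).

(** Negation, like disjunction, rests on truth sets being decided by [large_dec], hence the
    restriction to Delta0 formulas. *)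
Lemma los_not p : isD0 p -> los p -> los (fneg p).
Proof.
intros Hp IH e eq se He; simpl. rewrite (IH e eq se He). split.
- intros H. destruct (large_dec _ (Xset_sat p Hp e se (represents_Rec _ _ He))); tauto.
- intros H1 H2. apply (large_const False), (large_mono2 _ _ _ H1 H2). tauto.
Qed.

Lemma los_or p q : isD0 p -> los p -> los q -> los (for_ p q).
Proof.
intros Hp IHp IHq e eq se He; simpl. rewrite (IHp e eq se He), (IHq e eq se He). split.
- intros [H|H]; apply (large_mono _ _ H); tauto.
- intros H. destruct (large_dec _ (Xset_sat p Hp e se (represents_Rec _ _ He))) as [H'|H'];
    [now left|right]. apply (large_mono2 _ _ _ H H'); tauto.
Qed.

Lemma los_bex t p : isD0 p -> los p -> los (fbex t p).
Proof.
intros Hp IH e eq se He; simpl.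
assert (Re := represents_Rec _ _ He). assert (Ht := teval_ultra e eq t He). split.
- intros (q & Hq & Hs).
  apply (IH (scons (repr q) e)) in Hs;
    [|apply represents_scons; [apply Rec_repr|now apply large_all|assumption]].
  apply (large_mono2 _ _ _ (large_and _ _ Hq Ht) Hs). intros i [H1 E] H2.
  exists (repr q i). rewrite scons_app in H2. rewrite <- E. auto.
- intros H.
  set (R := fun i a => a < teval M (fun n => e n i) t /\
    sat M S mem p (scons a (fun n => e n i)) se).
  assert (HR : Sg2 R).
  { apply Xset_Sg, Xset_and.
    - assert (HT := Rec_teval e t Re).
      apply Xset_lt; [rec|apply (Rec_comp _ _ HT Rec_p1)].
    - apply (Xset_ext _ _ (Xset_sat p Hp (bind e) se (Rec_bind e Re))).
      intros j; now rewrite bind_app. }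
  destruct (large_skolem R HR H) as (g & Rg & Hg).
  exists (mk g); split.
  + apply (large_mono2 _ _ _ (large_and _ _ Hg Ht) (repr_mk g Rg)).
    intros i [[H1 _] E] E'. now rewrite E, E'.
  + apply (IH (scons g e)); [apply represents_scons; auto|].
    apply (large_mono _ _ Hg). intros i [_ H2]. now rewrite scons_app.
Qed.

Lemma los_ext p q : los p ->
  (forall A (T : Type) (m : car A -> T -> Prop) e se, sat A T m p e se <-> sat A T m q e se) ->
  los q.
Proof.
intros Hp H e eq se He. rewrite <- H, (Hp e eq se He).
split; intros L; apply (large_mono _ _ L); intros i; apply H.
Qed.

Lemma los_D0 p : isD0 p -> los p.
Proof.
induction 1 as [t u|t u|t j|p Hp IHp|p q Hp IHp Hq IHq|p q Hp IHp Hq IHq|p q Hp IHp Hq IHq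
  |t p Hp IHp|t p Hp IHp].
- intros e eq se He; simpl.
  assert (L := large_and _ _ (teval_ultra e eq t He) (teval_ultra e eq u He)). split.
  + intros H. rewrite H in L. apply (large_mono _ _ L). intros i [E E']; congruence.
  + intros H. apply repr_inj, (large_mono2 _ _ _ L H). intros i [E E'] E2; congruence.
- intros e eq se He; simpl.
  assert (L := large_and _ _ (teval_ultra e eq t He) (teval_ultra e eq u He)).
  split; intros H; apply (large_mono2 _ _ _ L H); intros i [E E'] E2; congruence.
- intros e eq se He; simpl. assert (L := teval_ultra e eq t He).
  split; intros H; apply (large_mono2 _ _ _ L H); intros i E E2; congruence.
- now apply los_not.
- intros e eq se He; simpl. rewrite (IHp e eq se He), (IHq e eq se He). split.
  + intros [H H']. now apply large_and.
  + intros H; split; apply (large_mono _ _ H); tauto.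
- now apply los_or.
- apply (los_ext (for_ (fneg p) q)).
  + apply los_or; [now constructor|now apply los_not|assumption].
  + intros; simpl; tauto.
- apply (los_ext (fneg (fbex t (fneg p)))).
  + apply los_not; [repeat constructor; assumption|].
    apply los_bex; [now constructor|now apply los_not].
  + intros; simpl; split; [|intros H (a & Ha & N); auto].
    intros H a Ha; apply NNPP; eauto.
- now apply los_bex.
Qed.

Lemma los_Sigma1 p : isSigma 1 p -> los p.
Proof.
revert p; refine (isSigma1_ind _ _ _); [intros p Hp|intros p Hp IH]; [now apply los_D0|].
intros e eq se He; simpl; split.
- intros (q & Hs).
  apply (IH (scons (repr q) e)) in Hs;
    [|apply represents_scons; [apply Rec_repr|now apply large_all|assumption]].
  apply (large_mono _ _ Hs). intros i H2. rewrite scons_app in H2. eauto.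
- intros H. assert (Re := represents_Rec _ _ He).
  destruct (large_skolem (fun i a => sat M S mem p (scons a (fun n => e n i)) se))
    as (g & Rg & Hg); [|assumption|].
  + apply (Sg_ext _ _ (Sg_sat p Hp (bind e) se (Rec_bind e Re))).
    intros j; now rewrite bind_app.
  + exists (mk g). apply (IH (scons g e)); [apply represents_scons; auto|].
    apply (large_mono _ _ Hg). intros i H2. now rewrite scons_app.
Qed.

(** Only one direction: the truth set of a Pi1 formula need not be in [X], so [large_dec] does not
    apply to it. *)
Lemma Pi1_upward p : isPi 1 p -> forall e eq se, represents e eq ->
  large (fun i => sat M S mem p (fun n => e n i) se) -> sat ultra S umem p eq se.
Proof.
revert p; refine (isPi1_ind _ _ _); [intros p Hp|intros p Hp IH]; intros e eq se He H.
- now apply (los_D0 p Hp e).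
- intros q. apply (IH (scons (repr q) e)).
  + apply represents_scons; [apply Rec_repr|now apply large_all|assumption].
  + apply (large_mono _ _ H). intros i Hi. rewrite scons_app. apply Hi.
Qed.

(** Failure at every index makes the Sigma1 relation of being a counterexample total, so
    [Rec_choice] yields one element of the ultrapower that refutes the outer quantifier. *)
Lemma Pi1_refute p : isPi 1 p -> forall e eq se, represents e eq ->
  (forall i, ~ sat M S mem p (fun n => e n i) se) -> ~ sat ultra S umem p eq se.
Proof.
revert p; refine (isPi1_ind _ _ _); [intros p Hp|intros p Hp IH]; intros e eq se He H HK.
- apply (los_D0 p Hp e) in HK; [|assumption].
  destruct (large_ex _ 0 HK) as (i & _ & Hi). now apply (H i).
- assert (Re := represents_Rec _ _ He).
  destruct (Rec_choice (fun i a => ~ sat M S mem p (scons a (fun n => e n i)) se))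
    as (g & Rg & Hg).
  + apply (Sg_ext _ _ (Sg_not_sat p Hp (bind e) se (Rec_bind e Re))).
    intros j; now rewrite bind_app.
  + intros i. apply not_all_ex_not. exact (H i).
  + apply (IH (scons g e) (scons (mk g) eq) se); [apply represents_scons; auto| |apply HK].
    intros i. rewrite scons_app. apply Hg.
Qed.

(** A formula failing at [i] rejects every candidate witness there, in particular the value at [i]
    of a proposed witness [q]. *)
Lemma Sigma2_refute p : isSigma 2 p -> forall e eq se, represents e eq ->
  (forall i, ~ sat M S mem p (fun n => e n i) se) -> ~ sat ultra S umem p eq se.
Proof.
revert p; refine (isSigma2_ind _ _ _); [intros p Hp|intros p Hp IH]; intros e eq se He H HK.
- now apply (Pi1_refute p Hp e eq se).
- destruct HK as [q Hq]. apply (IH (scons (repr q) e) (scons q eq) se); [| |assumption].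
  + apply represents_scons; [apply Rec_repr|now apply large_all|assumption].
  + intros i Hi. rewrite scons_app in Hi. apply (H i). now exists (repr q i).
Qed.

Lemma repr_emb m : large (fun i => repr (emb m) i = m).
Proof. apply repr_mk, Rec_const. Qed.

Lemma represents_emb (e : nat -> V) : represents (fun n _ => e n) (fun n => emb (e n)).
Proof. intros n; split; [apply Rec_const|apply repr_emb]. Qed.

(** Over a constant environment the witness is a constant too; along varying parameters, witnesses
    for a Pi1 matrix could not be found by search. *)
Lemma Sigma2_upward p : isSigma 2 p -> forall (e : nat -> V) eq se,
  represents (fun n _ => e n) eq -> sat M S mem p e se -> sat ultra S umem p eq se.
Proof.
revert p; refine (isSigma2_ind _ _ _); [intros p Hp|intros p Hp IH]; intros e eq se He H.
- apply (Pi1_upward p Hp (fun n _ => e n)); [assumption|]. now apply large_all.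
- destruct H as [a Ha]. exists (emb a). apply (IH (scons a e)); [|assumption].
  intros [|n]; simpl; [|apply He]. split; [apply Rec_const|apply repr_emb].
Qed.

Lemma ultra_elementary : Sigma_elementary 2 M ultra S mem umem emb.
Proof.
intros p Hp e se; split.
- apply (Sigma2_upward p Hp), represents_emb.
- intros H; apply NNPP; intros N; revert H.
  apply (Sigma2_refute p Hp (fun n _ => e n)); [apply represents_emb|auto].
Qed.

Lemma emb_eq a b : emb a = emb b <-> a = b.
Proof.
split; [|congruence]. intros H. apply large_const.
apply (large_mono2 _ _ _ (repr_emb a) (repr_emb b)). intros i; congruence.
Qed.

Lemma emb_lt a b : lt M a b <-> lt ultra (emb a) (emb b).
Proof.
simpl. assert (L := large_and _ _ (repr_emb a) (repr_emb b)). split; intros H.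
- apply (large_mono _ _ L). intros i [-> ->]; assumption.
- apply large_const, (large_mono2 _ _ _ L H). intros i [-> ->]; auto.
Qed.

Lemma emb_mem a Y : umem (emb a) Y <-> mem a Y.
Proof.
unfold umem; split; intros H.
- apply large_const, (large_mono2 _ _ _ (repr_emb a) H). intros i ->; auto.
- apply (large_mono _ _ (repr_emb a)). intros i ->; auto.
Qed.

Lemma emb_add a b : emb (a + b) = add ultra (emb a) (emb b).
Proof.
apply repr_inj. simpl.
assert (L := large_and _ _ (repr_emb a) (repr_emb b)).
assert (R := repr_mk _ (Rec_add _ _ (Rec_repr (emb a)) (Rec_repr (emb b)))).
apply (large_mono2 _ _ _ (large_and _ _ L R) (repr_emb (a + b))).
intros i [[E1 E2] E3] E4; congruence.
Qed.

Lemma emb_mul a b : emb (a * b) = mul ultra (emb a) (emb b).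
Proof.
apply repr_inj. simpl.
assert (L := large_and _ _ (repr_emb a) (repr_emb b)).
assert (R := repr_mk _ (Rec_mul _ _ (Rec_repr (emb a)) (Rec_repr (emb b)))).
apply (large_mono2 _ _ _ (large_and _ _ L R) (repr_emb (a * b))).
intros i [[E1 E2] E3] E4; congruence.
Qed.

(** By the bound decision at a + 1, either [k] is at least that on a large set, or it is constant
    there and so equals an embedded element. *)
Lemma ultra_end : end_extension M ultra emb.
Proof.
intros k Hk a; simpl.
destruct (large_bound (repr k) (a + 1) (Rec_repr k)) as [H|(c & _ & H)].
- apply (large_mono2 _ _ _ H (repr_emb a)). intros i Hi ->. now apply succ_le_iff.
- exfalso; apply (Hk c), repr_inj, (large_mono2 _ _ _ H (repr_emb c)).
  intros i; congruence.
Qed.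

(** The identity function is not constant on a large set, as large sets are unbounded. *)
Lemma ultra_proper : proper_extension M ultra emb.
Proof.
exists (mk (fun i => i)). intros a E.
assert (L := repr_mk _ Rec_id). rewrite E in L.
destruct (large_ex _ a (large_and _ _ (repr_emb a) L)) as (i & Hi & E1 & E2).
apply (lt_irrefl a). congruence.
Qed.

Lemma ultra_BSigma1 : BSigma ultra S umem 1.
Proof.
intros p Hp eq se a H.
set (e := fun n => repr (eq n)).
assert (He : represents e eq).
{ intros n; split; [apply Rec_repr|now apply large_all]. }
assert (Re := represents_Rec _ _ He).
assert (Hxy : forall F G x y, Rec F -> Rec G ->
  large (fun i => repr x i = F i) -> large (fun i => repr y i = G i) ->
  (sat ultra S umem p (scons y (scons x eq)) se <->
   large (fun i => sat M S mem p (scons (G i) (scons (F i) (fun n => e n i))) se))).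
{ intros F G x y HF HG Hx Hy.
  rewrite (los_Sigma1 p Hp (scons G (scons F e))) by (repeat apply represents_scons; auto).
  split; intros L; apply (large_mono _ _ L); intros i; now rewrite !scons_app. }
assert (HP : Sg (fun j => sat M S mem p
  (scons (p2 j) (scons (p2 (p1 j)) (fun n => e n (p1 (p1 j))))) se)).
{ apply (Sg_ext _ _ (Sg_sat p Hp (bind (bind e)) se (Rec_bind _ (Rec_bind _ Re)))).
  intros j; now rewrite !bind_app. }
destruct HP as [Y HY].
(* [z] packs the value [y] with a witness of the Sigma1 formula, so that bounding [z] also bounds
   [y]. *)
assert (HZ : Xset (fun t => mem (pair (pair (p1 t) (p1 (p2 t))) (p2 (p2 t))) Y)) by xset.
destruct HZ as [Z HZ].
assert (HZ1 : forall i x z, mem (pair (pair i x) z) Z ->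
  sat M S mem p (scons (p1 z) (scons x (fun n => e n i))) se).
{ intros i x z Hz. apply HZ in Hz. rewrite p1_pair, p2_pair in Hz.
  specialize (proj2 (HY _) (ex_intro _ _ Hz)). now rewrite !p1_pair, !p2_pair. }
assert (HZ2 : forall i x y, sat M S mem p (scons y (scons x (fun n => e n i))) se ->
  exists z, mem (pair (pair i x) z) Z).
{ intros i x y Hs. destruct (proj1 (HY (pair (pair i x) y))) as [w Hw].
  - now rewrite !p1_pair, !p2_pair.
  - exists (pair y w). apply HZ. now rewrite !p1_pair, !p2_pair, p1_pair. }
destruct (large_bounded_choice (repr a) Z (Rec_repr a)) as [(b & Rb & Hb)|(g & Rg & Hg)].
(* For each [x] a Skolem function picks [z] below [b]; its first component is the value and is at
   most [z]. *)
- exists (mk b). intros x Hx. assert (Rx := Rec_repr x).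
  destruct (large_skolem (fun i z => z < b i /\ mem (pair (pair i (repr x i)) z) Z))
    as (g & Rg & Hg).
  + sg.
  + apply (large_mono2 _ _ _ Hx Hb). intros i H1 H2. exact (H2 _ H1).
  + assert (Rpg : Rec (fun i => p1 (g i))) by rec.
    exists (mk (fun i => p1 (g i))). split.
    * apply (large_mono2 _ _ _ (large_and _ _ (repr_mk _ Rpg) (repr_mk b Rb)) Hg).
      intros i [E1 E2] [H1 _]. rewrite E1, E2. now apply (le_lt_trans _ (g i)); [apply p1_le|].
    * apply (Hxy (repr x) (fun i => p1 (g i))); auto; [now apply large_all|].
      apply (large_mono _ _ Hg). intros i [_ H2]. now apply HZ1.
(* [mk g] is below [a] and has no witness on a large set, against the premise of collection. *)
- exfalso. destruct (H (mk g)) as [y Hy].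
  + apply (large_mono2 _ _ _ (repr_mk g Rg) Hg). intros i E [H1 _]. now rewrite E.
  + apply (Hxy g (repr y)) in Hy; auto; [|now apply large_all].
    apply (large_const False), (large_mono2 _ _ _ Hy Hg).
    intros i H1 [_ H2]. destruct (HZ2 _ _ _ H1) as [z Hz]. now apply (H2 z).
Qed.

End Ultrapower.

Lemma ultrapower_exists :
  exists (K : arith) (memK : car K -> S -> Prop) (f : V -> car K),
    ((forall a b, f a = f b -> a = b) /\
      f 0 = zero K /\ f 1 = one K /\
      (forall a b, f (a + b) = add K (f a) (f b)) /\
      (forall a b, f (a * b) = mul K (f a) (f b)) /\
      (forall a b, a < b <-> lt K (f a) (f b)) /\
      (forall a Y, memK (f a) Y <-> mem a Y)) /\
      end_extension M K f /\ proper_extension M K f /\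
      Sigma_elementary 2 M K S mem memK f /\ BSigma K S memK 1.
Proof.
destruct generic_sequence as (U & HU & UU & Udec & Ureq).
destruct (quotient_ex U Udec) as (Q & repr & Rr & Hmk & Hinj).
assert (q0 : inhabited Q).
{ destruct (Hmk (fun _ => 0) (Rec_const 0)) as [q _]; exact (inhabits q). }
set (mk := fun F => epsilon q0 (fun q => large U (fun i => repr q i = F i))).
assert (Hr : forall F, Rec F -> large U (fun i => repr (mk F) i = F i)).
{ intros F HF; unfold mk; apply epsilon_spec, Hmk, HF. }
exists (ultra U Q repr mk), (umem U Q repr), (emb Q mk). repeat split.
- intros a b; now apply (emb_eq U UU Udec Q repr mk).
- now apply emb_add.
- now apply emb_mul.
- now apply emb_lt.
- now apply emb_lt.
- now apply emb_mem.
- now apply emb_mem.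
- now apply ultra_end.
- now apply ultra_proper.
- now apply ultra_elementary.
- now apply ultra_elementary.
- now apply ultra_BSigma1.
Qed.

End Model.

(** * From countability to enumerations, the case of no sets, and the final assembly *)

Lemma countable_enumeration (T : Type) (t0 : T) :
  countable T -> exists e : nat -> T, forall t, exists n, e n = t.
Proof.
intros [f Hf]. exists (fun n => epsilon (inhabits t0) (fun t => f t = n)).
intros t; exists (f t). apply Hf, epsilon_spec. now exists t.
Qed.

(* Every satisfaction scheme quantifies over set assignments [nat -> setsOf M X],
   so all of them are vacuous when [X] is empty. *)
Lemma no_sets_extension (M : arith) (X : (car M -> Prop) -> Prop) :
  (setsOf M X -> False) ->
  exists (K : arith) (memK : car K -> setsOf M X -> Prop) (f : car M -> car K),
    is_extension M K X memK f /\ end_extension M K f /\ proper_extension M K f /\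
      Sigma_elementary 2 M K (setsOf M X) (memOf M X) memK f /\
      BSigma K (setsOf M X) memK 1.
Proof.
intros HX.
set (lift := fun (op : car M -> car M -> car M) (a b : option (car M)) =>
  match a, b with Some x, Some y => Some (op x y) | _, _ => None end).
(* A single point [None] is put on top of [M]; any operation involving it returns it. *)
exists {| car := option (car M); zero := Some (zero M); one := Some (one M);
  add := lift (add M); mul := lift (mul M);
  lt := fun a b => match a, b with
    | Some x, Some y => lt M x y
    | Some _, None => True
    | None, _ => False
    end |}, (fun _ Y => False_rect _ (HX Y)), (@Some (car M)).
split; [|split; [|split; [|split]]].
- repeat split; simpl; auto; try tauto.
  + intros a b E; now injection E.
  + destruct (HX Y).
  + destruct (HX Y).
- intros [k|] Hk a; simpl; [now destruct (Hk k)|exact I].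
- exists None; discriminate.
- intros phi _ e se. destruct (HX (se O)).
- intros phi _ e se. destruct (HX (se O)).
Qed.

Theorem theorem4p1 :
  forall (M : arith) (X : (car M -> Prop) -> Prop),
    countable (car M) ->
    countable (setsOf M X) ->
    BSigma M (setsOf M X) (memOf M X) 2 ->
    WKL0 M (setsOf M X) (memOf M X) ->
    exists (K : arith) (memK : car K -> setsOf M X -> Prop) (f : car M -> car K),
      is_extension M K X memK f /\
      end_extension M K f /\
      proper_extension M K f /\
      Sigma_elementary 2 M K (setsOf M X) (memOf M X) memK f /\
      BSigma K (setsOf M X) memK 1.
Proof.
intros M X HM HX HB [(Hbasic & Hind & Hca) Hwkl].
destruct (classic (inhabited (setsOf M X))) as [[Y]|N].
- destruct (countable_enumeration _ (zero M) HM) as [e0 He0].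
  destruct (countable_enumeration _ Y HX) as [se0 Hse0].
  exact (ultrapower_exists (memOf M X) Hbasic Hind Hca HB Hwkl e0 He0 se0 Hse0).
- apply no_sets_extension. intros Y; apply N; now constructor.
Qed.
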